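(* For every integer $k\geq 4$ and even integer $n$, \[R_k(C_n)\leq \left(k-\frac{1}{2}+o(1)\right)n,\] where $o(1)$ denotes a quantity tending to $0$ as $n\to\infty$ (with $k$ fixed).
   Context: $C_n$ denotes the cycle on $n$ vertices. The multicolor Ramsey number $R_k(H)$ is the smallest positive integer $N$ such that every coloring of the edges of the complete graph $K_N$ with $k$ colors contains a monochromatic copy of $H$. *)

(* Defs.v *)
From mathcomp Require Import all_boot.

Set Implicit Arguments.
Unset Strict Implicit.
Unset Printing Implicit Defensive.

Record sgraph := SGraph {
  vertex :> finType;
  adj : rel vertex;
  adj_sym : symmetric adj;
  adj_irrefl : irreflexive adj }.

Definition edge_set (G : sgraph) : {set {set G}} :=
  [set [set p.1; p.2] | p : G * G & adj p.1 p.2].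

Definition edge (G : sgraph) : finType := {e : {set G} | e \in edge_set G}.

Definition edge_colouring (G : sgraph) (k : nat) : finType :=
  {ffun edge G -> 'I_k}.

Definition colour_adj (G : sgraph) (k : nat) (c : edge_colouring G k)
    (i : 'I_k) : rel G :=
  fun x y => [exists e : edge G, (val e == [set x; y]) && (c e == i)].

Lemma colour_adj_sym G k (c : edge_colouring G k) i :
  symmetric (colour_adj c i).
Proof. by move=> x y; rewrite /colour_adj setUC. Qed.

Lemma edge_set_neq (G : sgraph) (x y : G) :
  [set x; y] \in edge_set G -> x != y.
Proof.
case/imsetP=> -[a b] /=; rewrite inE => ab eab; apply/eqP => exy.
have nab : a != b by apply/eqP => e; rewrite e adj_irrefl in ab.
by have := cards2 a b; rewrite -eab exy setUid cards1 nab.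
Qed.

Lemma colour_adj_irrefl G k (c : edge_colouring G k) i :
  irreflexive (colour_adj c i).
Proof.
move=> x; apply/negbTE/negP => /existsP[e] /andP[/eqP ve _].
by have := valP e; rewrite /= ve => /edge_set_neq; rewrite eqxx.
Qed.

Definition colour_class (G : sgraph) (k : nat) (c : edge_colouring G k)
    (i : 'I_k) : sgraph :=
  SGraph (colour_adj_sym c i) (colour_adj_irrefl c i).

(* Copies are not required to be induced. *)
Definition contains_copy (H G : sgraph) : bool :=
  [exists f : {ffun H -> G},
     injectiveb f && [forall x, forall y, adj x y ==> adj (f x) (f y)]].

Lemma complete_adj_sym n : symmetric (fun x y : 'I_n => x != y).
Proof. by move=> x y; rewrite eq_sym. Qed.

Lemma complete_adj_irrefl n : irreflexive (fun x y : 'I_n => x != y).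
Proof. by move=> x; rewrite eqxx. Qed.

Definition complete_graph (n : nat) : sgraph :=
  SGraph (@complete_adj_sym n) (@complete_adj_irrefl n).

Definition cycle_adj (n : nat) : rel 'I_n :=
  fun i j => (i != j) && ((i.+1 %% n == j) || (j.+1 %% n == i)).

Lemma cycle_adj_sym n : symmetric (@cycle_adj n).
Proof. by move=> i j; rewrite /cycle_adj eq_sym orbC. Qed.

Lemma cycle_adj_irrefl n : irreflexive (@cycle_adj n).
Proof. by move=> i; rewrite /cycle_adj eqxx. Qed.

(* A cycle only when 3 <= n: cycle_graph 2 is a single edge. *)
Definition cycle_graph (n : nat) : sgraph :=
  SGraph (@cycle_adj_sym n) (@cycle_adj_irrefl n).

Definition ramsey_prop (k : nat) (H : sgraph) (N : nat) : bool :=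
  (0 < N) &&
  [forall c : edge_colouring (complete_graph N) k,
     exists i : 'I_k, contains_copy H (colour_class c i)].

Lemma ramsey_clique k n (s : 'I_k -> nat) :
  \sum_i s i = n ->
  exists N, forall (T : finType) (E : 'I_k -> rel T),
    (forall i, symmetric (E i)) ->
    (forall x y, x != y -> exists i, E i x y) ->
    forall A : {set T}, N <= #|A| ->
    exists i, exists B : {set T}, s i <= #|B| /\
      {in B &, forall x y, x != y -> E i x y}.
Proof.
elim: n s => [|n IH] s hs; last first.
  case: (boolP [exists i, s i == 0]) => [/existsP[i /eqP si]|].
    exists 0 => T E _ _ A _; exists i, set0; rewrite si; split=> // x y.
    by rewrite inE.
  rewrite negb_exists => /forallP s_gt0.
  pose s' i j := s j - (j == i).
  have /fin_all_exists[N hN] : forall i, exists N,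
    forall (T : finType) (E : 'I_k -> rel T),
    (forall i, symmetric (E i)) ->
    (forall x y, x != y -> exists i, E i x y) ->
    forall A : {set T}, N <= #|A| ->
    exists j, exists B : {set T}, B \subset A /\ s' i j <= #|B| /\
      {in B &, forall x y, x != y -> E j x y}.
    move=> i; have [|N hN] := IH (s' i).
      apply/eqP; rewrite -eqSS -hs (bigD1 i) //= [in X in _ == X](bigD1 i) //=.
      rewrite /s' eqxx subn1 -addSn prednK ?lt0n //; apply/eqP; congr addn.
      by apply: eq_bigr => j /negbTE ->; rewrite subn0.
    exists N => T E Es Et A hA.
    have [|||j [B [sB cB]]] := hN {x : T | x \in A}
      (fun i x y => E i (val x) (val y)) _ _ setT.
    - by move=> j x y; rewrite Es.
    - by move=> x y nxy; apply: Et.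
    - by rewrite cardsT card_sig.
    exists j, (val @: B); split; [|split].
    - by apply/subsetP => _ /imsetP[x _ ->]; exact: valP.
    - by rewrite card_imset //; exact: val_inj.
    - by move=> _ _ /imsetP[x xB ->] /imsetP[y yB ->] nxy; apply: cB.
  exists (2 + \sum_i N i) => T E Es Et A hA.
  have /card_gt0P[x xA] : 0 < #|A| by apply: leq_trans hA.
  pose A' i := [set y in A | (y != x) && E i x y].
  have [i hi] : exists i, N i <= #|A' i|.
    apply/existsP; apply: contraLR hA; rewrite negb_exists => /forallP h.
    rewrite -ltnNge (cardsD1 x A) xA !addSn add0n !ltnS.
    apply: (@leq_trans (\sum_i #|A' i|)); last first.
      by apply: leq_sum => i _; rewrite ltnW // ltnNge h.
    apply: (@leq_trans #|\bigcup_i A' i|).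
      apply: subset_leq_card; apply/subsetP => y; rewrite !inE => /andP[yx yA].
      have [|i xy] := Et x y; first by rewrite eq_sym.
      by apply/bigcupP; exists i => //; rewrite inE yA yx.
    elim/big_ind2: _ => [|m1 B1 m2 B2 h1 h2|//]; first by rewrite cards0.
    by rewrite (leq_trans (leq_card_setU _ _)) ?leq_add.
  have [j [B [BA [sB cB]]]] := hN i T E Es Et _ hi.
  case: (eqVneq j i) => [ji|ji]; last first.
    by exists j, B; split=> //; move: sB; rewrite /s' (negbTE ji) subn0.
  subst j; exists i, (x |: B); split.
    have xB : x \notin B.
      by apply/negP => /(subsetP BA); rewrite inE eqxx andbF.
    by rewrite cardsU1 xB; move: sB; rewrite /s' eqxx leq_subLR.
  have Ex y : y \in B -> E i x y by move/(subsetP BA); rewrite inE => /and3P[].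
  move=> y z /setU1P[->|yB] /setU1P[->|zB]; rewrite ?eqxx // => nyz.
  - exact: Ex.
  - by rewrite Es; exact: Ex.
  - exact: cB.
exists 2 => T E Es Et A hA.
have /card_gt1P[x [y [_ _ xy]]] := hA.
have [i _] := Et x y xy; exists i, set0; split; last by move=> ? ?; rewrite inE.
by move/eqP: hs; rewrite sum_nat_eq0 => /forallP /(_ i) /eqP ->.
Qed.

Lemma ramsey_exists (k : nat) (H : sgraph) : exists N, ramsey_prop k H N.
Proof.
have [N hN] := @ramsey_clique k _ (fun=> #|H|) erefl.
exists N.+1; apply/andP; split=> //; apply/forallP => c.
have [|||i [B [sB cB]]] := hN _ (colour_adj c) _ _ setT.
- exact: colour_adj_sym.
- move=> x y xy.
  have exy : [set x; y] \in edge_set (complete_graph N.+1).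
    by apply/imsetP; exists (x, y); rewrite // inE.
  pose e : edge (complete_graph N.+1) :=
    exist (fun e => e \in edge_set (complete_graph N.+1)) _ exy.
  by exists (c e); apply/existsP; exists e; rewrite !eqxx.
- by rewrite cardsT card_ord.
apply/existsP; exists i; apply/existsP.
pose f (h : H) := enum_val (widen_ord sB (enum_rank h)).
have fI : injective f.
  by move=> x y /enum_val_inj /(congr1 val) /= /val_inj /enum_rank_inj.
exists (finfun f); apply/andP; split.
  by apply/injectiveP => x y; rewrite !ffunE => /fI.
apply/forallP => x; apply/forallP => y; apply/implyP => xy.
rewrite !ffunE; apply: cB; rewrite ?enum_valP // (inj_eq fI).
by apply/eqP => e; rewrite e adj_irrefl in xy.
Qed.

Definition ramsey_number (k : nat) (H : sgraph) : nat :=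
  ex_minn (ramsey_exists k H).

(* Main.v *)
Require Import Defs.
From mathcomp Require Import all_boot zify.

Set Implicit Arguments.
Unset Strict Implicit.
Unset Printing Implicit Defensive.

(* Let [N] slightly exceed [(k - 1/2) n] and suppose that no colour contains
   [C_n].  Deleting few edges of a colour class leaves a graph each of whose
   components [D] has disjoint sets [S], [R] such that every edge of [D] meets
   [S] or lies inside [R], and [2|S| + |R| <= m], where [m = (1 + o(1)) n]:
   partition the vertices so that nearly all pairs of cells are either almost
   empty or "thick", blow up the graph of thick pairs, and apply Koenig's
   theorem to the bipartite double cover of a component.  A matching there with
   more than [m] edges would give a closed walk of length [n] through thick
   pairs that does not exhaust any cell, along which [C_n] is found greedily.

   It remains to count.  Let [Y] be the union of the sets [S] over all colours
   and components, and [U] its complement.  Count the pairs with first vertex in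
   [Y], charging each edge between [S] and [Y \ S] twice to its end outside [S]:
   a vertex is charged at most [m] in each colour, and only [|U ∩ D| + |S|] in a
   colour for which it lies in [S].  The latter is at most [m/2]: the edges
   joining [U ∩ D] to the complement of [S ∪ R] have only [k - 1] colours, so
   Gyarfas' double-star argument finds a monochromatic component that would
   otherwise be too large; the same argument shows that [Y] is not small.  Hence [N |Y| <= (k - 1/2) m |Y|] up to lower-order
   terms. *)

(** * Hall's theorem *)

(** Induction on [|L|]. If some proper nonempty [X] is tight, [X] and [L :\: X] are matched
    separately, the latter avoiding the neighbours of [X]. Otherwise each such set has a spare
    neighbour, so any edge at [x] may be fixed. [b0] makes [g] total. *)
Theorem hall (A B : finType) (b0 : B) (L : {set A}) (r : A -> {set B}) :
  (forall X : {set A}, X \subset L -> #|X| <= #|\bigcup_(x in X) r x|) ->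
  exists g : A -> B, {in L &, injective g} /\ {in L, forall x, g x \in r x}.
Proof.
have [n] := ubnP #|L|; elim: n => // n IH in L r * => hn hL.
have [->|/set0Pn[x xL]] := eqVneq L set0.
  by exists (fun=> b0); split=> ?; rewrite inE.
case: (boolP [exists X : {set A}, [&& X \proper L, X != set0 &
               #|\bigcup_(x in X) r x| <= #|X|]]).
- case/existsP=> X /and3P[XL X0 tX].
  set NX := \bigcup_(x in X) r x in tX.
  have sXL := proper_sub XL.
  have [||g1 [g1I g1r]] := IH X r.
  + by rewrite (leq_trans (proper_card XL)).
  + by move=> Y YX; apply: hL; apply: subset_trans sXL.
  have [||g2 [g2I g2r]] := IH (L :\: X) (fun x => r x :\: NX).
  + apply: leq_trans (_ : #|L| <= n); last by [].
    rewrite cardsD (setIidPr sXL) ltn_subrL card_gt0 X0.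
    by rewrite card_gt0; apply/set0Pn; exists x.
  + move=> Y /subsetDP[YL dYX].
    have := hL (X :|: Y); rewrite subUset sXL YL => /(_ isT).
    rewrite cardsU setIC (disjoint_setI0 dYX) cards0 subn0.
    have -> : \bigcup_(z in X :|: Y) r z
       = NX :|: \bigcup_(z in Y) (r z :\: NX).
      apply/setP=> b; apply/bigcupP/setUP.
        case=> z /setUP[zX|zY] bz; first by left; apply/bigcupP; exists z.
        case: (boolP (b \in NX)); first by left.
        by move=> nb; right; apply/bigcupP; exists z; rewrite // inE nb.
      case=> /bigcupP[z zZ bz]; exists z; rewrite ?inE ?zZ ?orbT //.
      by move: bz; rewrite inE => /andP[].
    move=> h; have := leq_trans h (leq_card_setU _ _); lia.
  exists (fun z => if z \in X then g1 z else g2 z); split.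
  + move=> y z yL zL.
    have key u v : u \in X -> v \in L -> v \notin X -> g1 u != g2 v.
      move=> uX vL vX; apply/eqP=> e.
      have := g2r v; rewrite inE vX vL -e => /(_ isT); rewrite inE.
      by case/andP=> /bigcupP[]; exists u => //; exact: g1r.
    case: ifPn => yX; case: ifPn => zX e.
    * exact: g1I.
    * by case/eqP: (key _ _ yX zL zX).
    * by case/eqP: (key _ _ zX yL yX).
    * by apply: g2I; rewrite // inE ?yX ?zX.
  + move=> z zL; case: ifPn => zX; first exact: g1r.
    by have := g2r z; rewrite !inE zX zL => /(_ isT) /andP[].
- rewrite negb_exists => /forallP tX.
  have : 0 < #|r x|.
    by have := hL [set x]; rewrite sub1set xL big_set1 cards1; apply.
  case/card_gt0P => y yx.
  have [||g2 [g2I g2r]] := IH (L :\ x) (fun x => r x :\ y).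
  + by move: hn; rewrite (cardsD1 x L) xL.
  + move=> Y /subsetD1P[YL xY].
    have [->|Y0] := eqVneq Y set0; first by rewrite cards0.
    have := tX Y; rewrite properE YL Y0 /=.
    case: (boolP (L \subset Y)) => [/subsetP/(_ _ xL)|_ /=].
      by rewrite (negbTE xY).
    rewrite -ltnNge.
    have -> : \bigcup_(z in Y) (r z :\ y) = (\bigcup_(z in Y) r z) :\ y.
      apply/setP=> b; apply/bigcupP/setD1P.
        case=> z zY /setD1P[nb bz]; split=> //; by apply/bigcupP; exists z.
      by case=> nb /bigcupP[z zY bz]; exists z; rewrite // !inE nb.
    rewrite (cardsD1 y (\bigcup_(z in Y) r z)); lia.
  exists (fun z => if z == x then y else g2 z); split.
  + move=> u v uL vL; case: eqVneq => [->|ux]; case: eqVneq => [->|vx] // e.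
    * by have := g2r v; rewrite !inE vx vL -e eqxx => /(_ isT).
    * by have := g2r u; rewrite !inE ux uL e eqxx => /(_ isT).
    * by apply: g2I; rewrite // !inE ?ux ?vx.
  + move=> z zL; case: eqVneq => [->|zx] //.
    by have := g2r z; rewrite !inE zx zL => /(_ isT) /andP[].
Qed.

(** If the first case fails, adding [d = |D| - (m + 1)] dummy vertices joined to everything restores
    Hall's condition; at most [d] elements are matched to dummies, so at least [m + 1] get real
    partners. *)
Lemma hall_deficiency (V : finType) (D : {set V}) (r : V -> {set V}) m :
  (exists X : {set V}, X \subset D /\
     #|D| + #|\bigcup_(x in X) r x| <= m + #|X|) \/
  (exists (X : {set V}) (g : V -> V), [/\ X \subset D, m < #|X|,
     {in X &, injective g} & {in X, forall x, g x \in r x}]).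
Proof.
case: (boolP [exists X : {set V}, (X \subset D) &&
               (#|D| + #|\bigcup_(x in X) r x| <= m + #|X|)]).
  by case/existsP=> X /andP[]; left; exists X.
rewrite negb_exists => /forallP hX; right.
have {}hX (X : {set V}) : X \subset D ->
    m + #|X| < #|D| + #|\bigcup_(x in X) r x|.
  by move=> XD; move: (hX X); rewrite XD -ltnNge.
have mD : m < #|D|.
  by have := hX set0 (sub0set _); rewrite big_set0 !cards0 !addn0.
have /card_gt0P[v0 v0D] : 0 < #|D| by apply: leq_ltn_trans mD.
pose d := #|D| - m.+1.
pose r' x : {set V + 'I_d} := inl @: r x :|: inr @: [set: 'I_d].
have [|g [gI gr]] := @hall V _ (inl v0) D r'.
  move=> X XD; have [->|/set0Pn[x xX]] := eqVneq X set0; first by rewrite cards0.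
  have -> : \bigcup_(x in X) r' x =
      inl @: (\bigcup_(x in X) r x) :|: inr @: [set: 'I_d].
    apply/setP=> -[b|b]; apply/bigcupP/setUP.
    - case=> z zX /setUP[/imsetP[c cz [->]]|/imsetP[c _ //]].
      by left; apply: imset_f; apply/bigcupP; exists z.
    - case=> [/imsetP[c /bigcupP[z zX cz] [->]]|/imsetP[c _ //]].
      by exists z => //; rewrite inE imset_f.
    - by right; rewrite imset_f.
    - by exists x => //; rewrite inE [X in _ || X]imset_f ?orbT.
  rewrite cardsU !card_imset; try by move=> ? ? [].
  rewrite (_ : _ :&: _ = set0) ?cards0 ?cardsT ?card_ord.
    by have := hX X XD; rewrite /d; lia.
  by apply/setP=> -[b|b]; rewrite !inE; apply/negbTE/negP;
    case/andP=> /imsetP[? _ ?] // /imsetP[? _ ?].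
pose X := [set x in D | if g x is inl _ then true else false].
exists X, (fun x => if g x is inl y then y else x); split.
- by apply/subsetP=> x; rewrite inE => /andP[].
- have XD : X \subset D by apply/subsetP=> x; rewrite inE => /andP[].
  have : #|D :\: X| <= d.
    rewrite -[X in _ <= X]card_ord -cardsT.
    rewrite -(card_in_imset (f := g) (D := mem (D :\: X))); last first.
      by move=> u v /setDP[uD _] /setDP[vD _]; exact: gI.
    rewrite -(card_imset [set: 'I_d] (f := @inr V _)); last by move=> ? ? [].
    apply: subset_leq_card; apply/subsetP=> _ /imsetP[x /setDP[xD xX] ->].
    have := gr _ xD; rewrite inE => /orP[/imsetP[y _ e]|//].
    by rewrite inE xD e in xX.
  by rewrite cardsD (setIidPr XD) /d; lia.
- move=> u v; rewrite !inE => /andP[uD hu] /andP[vD hv].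
  case eu: (g u) hu => [y|//] _; case ev: (g v) hv => [z|//] _ e.
  by apply: gI; rewrite // eu ev e.
- move=> u; rewrite !inE => /andP[uD]; have := gr _ uD.
  case: (g u) => // y; rewrite inE => /orP[/imsetP[z zr [->//]]|/imsetP[? _ //]].
Qed.

(** * Counting in covered colourings *)

Lemma sum_sqr_le (I : finType) (P : pred I) (a : I -> nat) :
  (\sum_(i | P i) a i) ^ 2 <= #|P| * \sum_(i | P i) a i ^ 2.
Proof.
rewrite -(leq_pmul2l (isT : 0 < 2)).
have -> : 2 * (\sum_(i | P i) a i) ^ 2 =
    \sum_(i | P i) \sum_(j | P j) 2 * (a i * a j).
  rewrite -mulnn big_distrl big_distrr /=; apply: eq_bigr => i _.
  by rewrite !big_distrr.
apply: leq_trans (_ : \sum_(i | P i) \sum_(j | P j) (a i ^ 2 + a j ^ 2) <= _).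
  by apply: leq_sum => i _; apply: leq_sum => j _; exact: nat_Cauchy.
under eq_bigr do rewrite big_split /= sum_nat_const.
rewrite big_split /= sum_nat_const -big_distrr /=; lia.
Qed.

Lemma double_count (V W : finType) (A : {set V}) (B : {set W}) (r : V -> W -> bool) :
  \sum_(a in A) #|[set b in B | r a b]| = \sum_(b in B) #|[set a in A | r a b]|.
Proof.
have e (T : finType) (C : {set T}) (p : pred T) :
    #|[set x in C | p x]| = \sum_(x in C) p x.
  rewrite -sum1_card big_mkcond [RHS]big_mkcond /=; apply: eq_bigr => x _.
  by rewrite inE; case: (x \in C); case: (p x).
under eq_bigr do rewrite e; under [RHS]eq_bigr do rewrite e.
exact: exchange_big.
Qed.

Lemma leq_card_bigcup (I T : finType) (P : pred I) (F : I -> {set T}) :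
  #|\bigcup_(i | P i) F i| <= \sum_(i | P i) #|F i|.
Proof.
elim/big_ind2: _ => [|m A n B hm hn|//]; first by rewrite cards0.
by rewrite (leq_trans (leq_card_setU _ _)) ?leq_add.
Qed.

Lemma card_setU_disjoint (T : finType) (A B : {set T}) :
  [disjoint A & B] -> #|A :|: B| = #|A| + #|B|.
Proof. by move=> dAB; rewrite cardsU (disjoint_setI0 dAB) cards0 subn0. Qed.

Lemma sum_cond_const (T : finType) (B : {set T}) (p : pred T) c :
  \sum_(w in B | p w) c = #|[set w in B | p w]| * c.
Proof. by rewrite -sum_nat_const; apply: eq_bigl => w; rewrite inE. Qed.

Section Count.
Variables (V I : finType) (H : I -> rel V) (comp : I -> V -> nat).
Variables (S R : I -> {set V}) (m t : nat).
Let cl i v := [set w | comp i w == comp i v].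
Let miss v := [set w | [forall i, ~~ H i v w]].
Hypothesis Hsym : forall i, symmetric (H i).
Hypothesis Hcomp : forall i v w, H i v w -> comp i v = comp i w.
Hypothesis Hcover : forall i v w, H i v w ->
  [\/ v \in S i, w \in S i | (v \in R i) && (w \in R i)].
Hypothesis SR : forall i, [disjoint S i & R i].
Hypothesis Hm : forall i v, 2 * #|S i :&: cl i v| + #|R i :&: cl i v| <= m.
Hypothesis Ht : \sum_v #|miss v| <= t ^ 2.
Hypothesis tm : t <= m.
Hypothesis m0 : 0 < m.
Hypothesis k3 : 2 < #|I|.

Let N := #|V|.
Let k := #|I|.
Hypothesis hN : 2 * k * m + 6 * t < 2 * N + m.

(** Besides the sets [S i], the complement [Y] takes in the vertices with more than [t] missing
    pairs; by [Ht] there are at most [t] of those. *)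
Let U := [set v | (#|miss v| <= t) && [forall i, v \notin S i]].
Let Y := ~: U.
Let A i v := (S i :|: R i) :&: cl i v.

Let cl_id i v : v \in cl i v. Proof. by rewrite inE. Qed.

Let cl_eq i v w : w \in cl i v -> cl i w = cl i v.
Proof. by rewrite inE => /eqP e; apply/setP=> x; rewrite !inE e. Qed.

Let H_cl i v w : H i v w -> w \in cl i v.
Proof. by move/Hcomp=> e; rewrite inE e. Qed.

Let card_A i v : #|A i v| = #|S i :&: cl i v| + #|R i :&: cl i v|.
Proof.
rewrite /A setIUl cardsU setIACA (disjoint_setI0 (SR i)) set0I cards0.
by rewrite subn0.
Qed.

Let U_S i u : u \in U -> u \notin S i.
Proof. by rewrite inE => /andP[_ /forallP]. Qed.

Let H_A i v w : H i v w -> v \notin S i -> w \in A i v.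
Proof.
move=> h nS; rewrite !inE; have := H_cl h; rewrite inE => ->; rewrite andbT.
by case: (Hcover h) => [vS|->|/andP[_ ->]]; rewrite ?orbT //; case/negP: nS.
Qed.

Let cover_le (W : {set V}) (P : pred I) v :
  (forall i w, w \in W -> H i v w -> P i) ->
  #|W| <= #|miss v| + \sum_(i | P i) #|[set w in W | H i v w]|.
Proof.
move=> hP.
apply: leq_trans (_ : #|miss v :|: \bigcup_(i | P i) [set w in W | H i v w]| <= _).
  apply: subset_leq_card; apply/subsetP=> w wW; rewrite inE inE.
  case: (boolP [forall i, _]) => //; rewrite negb_forall => /existsP[i].
  rewrite negbK => h /=; apply/bigcupP; exists i; last by rewrite inE wW.
  exact: hP h.
by rewrite (leq_trans (leq_card_setU _ _)) // leq_add2l leq_card_bigcup.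
Qed.

(** Otherwise the colour-[i] neighbours of [u] all lie in [S i], which allows at most [m / 2] of
    them. Each other colour gives at most [m], so [N <= (k - 1/2) m + t], contrary to [hN]. *)
Let U_R i u : u \in U -> u \in R i.
Proof.
move=> uU; apply: contraT => nR.
have := @cover_le setT xpredT u (fun _ _ _ _ => isT).
have ut : #|miss u| <= t by move: uU; rewrite inE => /andP[].
rewrite cardsT (bigD1 i) //=.
have h1 : 2 * #|[set w in [set: V] | H i u w]| <= m.
  apply: leq_trans (Hm i u); rewrite (leq_trans _ (leq_addr _ _)) //.
  rewrite leq_mul2l /=; apply: subset_leq_card; apply/subsetP=> w.
  rewrite in_setI !inE => h; have := H_cl h; rewrite inE => ->; rewrite andbT.
  case: (Hcover h) => [uS|//|/andP[uR]]; last by rewrite uR in nR.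
  by have := U_S i uU; rewrite uS.
have h2 : \sum_(j | j != i) #|[set w in [set: V] | H j u w]| <= k.-1 * m.
  rewrite -(cardC1 i) -sum_nat_const; apply: leq_sum => j _.
  apply: leq_trans (_ : #|A j u| <= m).
    apply: subset_leq_card; apply/subsetP=> w; rewrite !inE => h.
    by have := H_A h (U_S j uU); rewrite !inE.
  by rewrite card_A; have := Hm j u; lia.
move: hN k3; rewrite -/N -/k; nia.
Qed.

Let gyarfas i0 v : v \in U ->
  #|~: A i0 v| + #|U :&: cl i0 v| <= k.-1 * m + 2 * t.
Proof.
move=> vU; set P := (U :&: cl i0 v); set B := (~: A i0 v).
have PA u : u \in P -> u \in A i0 v.
  by case/setIP=> uU uc; rewrite !inE U_R // orbT; move: uc; rewrite inE.
have PU u : u \in P -> u \in U by case/setIP.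
have vP : v \in P by rewrite !inE eqxx andbT; move: vU; rewrite inE.
have p0 : 0 < #|P| by apply/card_gt0P; exists v.
have cA : #|A i0 v| <= m by rewrite card_A; have := Hm i0 v; lia.
have pm : #|P| <= m.
  by apply: leq_trans cA; apply: subset_leq_card; apply/subsetP.
have cB : #|B| = N - #|A i0 v| by rewrite cardsCs setCK.
have no0 u w : u \in P -> w \in B -> ~~ H i0 u w.
  move=> uP; rewrite inE; apply: contra => h.
  have := H_A h (U_S i0 (PU _ uP)).
  by rewrite /A (cl_eq (_ : u \in cl i0 v)) //; case/setIP: uP.
(* Double stars: [E] counts the triples (u, w, i) such that [uw] has colour [i].
   The colour-[i] neighbours of [u] in [B] and of [w] in [P] lie in the single
   set [A i u], whence [X + Z <= m * E]; Cauchy-Schwarz bounds [X] and [Z] below. *)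
pose d i u := #|[set w in B | H i u w]|.
pose d' i w := #|[set u in P | H i u w]|.
have dd i u w : u \in P -> w \in B -> H i u w -> d i u + d' i w <= m.
  move=> uP wB h; have := Hm i u.
  have: d i u + d' i w <= #|A i u|; last by rewrite card_A; lia.
  have dis : [disjoint [set w in B | H i u w] & [set u in P | H i u w]].
    rewrite disjoint_subset; apply/subsetP=> x; rewrite !inE => /andP[xB _].
    apply/negP=> /andP[xP _]; have := PA x; rewrite !inE => /(_ xP).
    by rewrite (negbTE xB).
  rewrite /d /d' -card_setU_disjoint //.
  apply: subset_leq_card; apply/subsetP=> x /setUP[]; rewrite inE => /andP[hx h'].
    exact: H_A h' (U_S i (PU _ uP)).
  rewrite !inE U_R ?PU // orbT /=.
  by rewrite (Hcomp h') (Hcomp h).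
set q := fun i : I => i != i0.
pose X := \sum_(u in P) \sum_(i | q i) d i u ^ 2.
pose Z := \sum_(w in B) \sum_(i | q i) d' i w ^ 2.
pose E := \sum_(u in P) \sum_(i | q i) d i u.
have E' : E = \sum_(w in B) \sum_(i | q i) d' i w.
  rewrite /E exchange_big /= [RHS]exchange_big /=; apply: eq_bigr => i _.
  exact: double_count.
have cq : #|q| = k.-1 by rewrite -(cardC1 i0); apply: eq_card.
have card2 (T : finType) (C : {set T}) (f : T -> I -> nat) :
    (\sum_(x in C) \sum_(i | q i) f x i) ^ 2 <=
    #|C| * k.-1 * \sum_(x in C) \sum_(i | q i) f x i ^ 2.
  rewrite !pair_big /=; apply: leq_trans (sum_sqr_le _ _) _.
  rewrite leq_mul2r; apply/orP; right.
  rewrite -cq -cardX; apply/eq_leq/eq_card => -[x i] /=.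
  by rewrite !inE.
have EX : E ^ 2 <= #|P| * k.-1 * X by exact: card2.
have EZ : E ^ 2 <= #|B| * k.-1 * Z by rewrite E'; exact: card2.
have XZ : X + Z <= m * E.
  have -> : X = \sum_(i | q i) \sum_(u in P) \sum_(w in B | H i u w) d i u.
    rewrite /X exchange_big /=; apply: eq_bigr => i _; apply: eq_bigr => u _.
    by rewrite sum_cond_const mulnn.
  have -> : Z = \sum_(i | q i) \sum_(u in P) \sum_(w in B | H i u w) d' i w.
    rewrite /Z exchange_big /=; apply: eq_bigr => i _.
    under [RHS]eq_bigr do rewrite big_mkcondr /=.
    rewrite [RHS]exchange_big /=; apply: eq_bigr => w _.
    by rewrite -big_mkcondr /= sum_cond_const mulnn.
  have -> : m * E = \sum_(i | q i) \sum_(u in P) \sum_(w in B | H i u w) m.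
    rewrite /E exchange_big big_distrr /=; apply: eq_bigr => i _.
    rewrite big_distrr /=; apply: eq_bigr => u _.
    by rewrite sum_cond_const mulnC.
  rewrite -big_split /=; apply: leq_sum => i _.
  rewrite -big_split /=; apply: leq_sum => u uP.
  rewrite -big_split /=; apply: leq_sum => w /andP[wB h].
  exact: dd.
have PB : #|P| * #|B| <= #|P| * t + E.
  rewrite -!sum_nat_const -big_split /=; apply: leq_sum => u uP.
  have := PU _ uP; rewrite inE => /andP[ut _].
  apply: leq_trans (leq_add ut (leqnn _)).
  apply: cover_le => i w wB h; apply/negP=> /eqP ei; subst i.
  by rewrite (negbTE (no0 _ _ uP wB)) in h.
have bm : t < #|B| /\ m <= #|B|.
  by rewrite cB; move: hN tm m0 k3; rewrite -/k; nia.
have E0 : 0 < E by case: bm; nia.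
(* Add [|B|] times [EX] to [|P|] times [EZ], apply [XZ] and cancel one factor [E]. *)
have h1 : E * (#|B| + #|P|) <= #|P| * #|B| * (k.-1 * m).
  rewrite -(leq_pmul2l E0).
  apply: leq_trans (_ : #|P| * #|B| * k.-1 * (X + Z) <= _).
    by move: EX EZ; rewrite expnS expn1; nia.
  apply: leq_trans (leq_mul (leqnn _) XZ) _; apply: eq_leq; lia.
(* By [PB], [E] is at least [|P| (|B| - t)]; insert this in [h1] and cancel [|P|]. *)
have h2 : #|B| * (#|B| + #|P|) <= #|B| * (k.-1 * m) + t * (#|B| + #|P|).
  rewrite -(leq_pmul2l p0); clear - h1 PB.
  move: h1 PB; move: (k.-1 * m) => K.
  move: #|P| #|B| => p b; nia.
(* As [|P| <= m <= |B|], the error [t (|B| + |P|)] is at most [2 t |B|]. *)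
have h3 : #|B| * (#|B| + #|P|) <= #|B| * (k.-1 * m + 2 * t).
  by move: bm h2 pm; clear; move: (k.-1 * m) #|P| #|B| => K p b; nia.
by move: h3; rewrite leq_pmul2l //; case: bm; lia.
Qed.

(** Within the component, [|S| <= m - |A|] by [Hm], and if [U] meets it then
    [|U| <= (k - 1) m + 2 t - N + |A|] by [gyarfas]. The terms [|A|] cancel in the sum, and [hN]
    leaves less than [m / 2]. *)
Let S_half i y : y \in S i -> 2 * (#|U :&: cl i y| + #|S i :&: cl i y|) <= m.
Proof.
move=> yS; have := Hm i y.
have [->|/set0Pn[v /setIP[vU vc]]] := eqVneq (U :&: cl i y) set0.
  by rewrite cards0; lia.
have := gyarfas i vU; rewrite cardsCs setCK card_A (cl_eq vc) -/N.
move: hN k3; rewrite -/k; nia.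
Qed.

(** For [v] in [U], the part of [A i v] outside [Y] lies in [U :&: cl i v], so [gyarfas] gives
    [N - |Y| <= (k - 1) m + 2 t]. *)
Let Y_large : m <= 2 * #|Y|.
Proof.
have [e|/set0Pn[v vU]] := eqVneq U set0.
  by rewrite /Y e setC0 cardsT -/N; move: hN k3; rewrite -/k; nia.
have /card_gt0P[i _] : 0 < #|I| by lia.
have := gyarfas i vU; rewrite cardsCs setCK -/N.
have : #|A i v| <= #|Y| + #|U :&: cl i v|.
  apply: leq_trans (leq_card_setU _ _).
  apply: subset_leq_card; apply/subsetP=> x /setIP[_ xc].
  by rewrite in_setU in_setI xc andbT inE; case: (x \in U).
move: hN k3 (Hm i v); rewrite -/k card_A; nia.
Qed.

(* Edges between [S i] and [Y :\: S i] are counted from both ends on the left;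
   [flip] moves both counts to the end outside [S i]. *)
Let charge i :
  2 * (\sum_(y in Y) #|[set w | H i y w]|) + m * #|S i| <= 2 * m * #|Y|.
Proof.
have SY : S i \subset Y.
  by apply/subsetP=> y yS; rewrite inE; apply/negP=> /(U_S i)/negP[].
pose hs y := #|[set w in S i | H i y w]|.
pose hy y := #|[set w in Y :\: S i | H i y w]|.
pose hu y := #|[set w in U | H i y w]|.
have split y : #|[set w | H i y w]| <= hs y + hy y + hu y.
  rewrite /hs /hy /hu.
  apply: leq_trans (_ : #|[set w in S i | H i y w] :|: [set w in Y :\: S i | H i y w]
      :|: [set w in U | H i y w]| <= _).
    apply: subset_leq_card; apply/subsetP=> w; rewrite inE => h.
    rewrite !in_setU !inE h !andbT.
    by case: (w \in S i) => //=; case: (_ <= _) => //=; case: [forall _, _].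
  apply: leq_trans (leq_card_setU _ _) _; rewrite leq_add2r.
  exact: leq_card_setU.
have hs_le y : hs y <= #|S i :&: cl i y|.
  apply: subset_leq_card; apply/subsetP=> w; rewrite inE => /andP[wS h].
  by rewrite in_setI wS (H_cl h).
have hu_le y : hu y <= #|U :&: cl i y|.
  apply: subset_leq_card; apply/subsetP=> w; rewrite inE => /andP[wU h].
  by rewrite in_setI wU (H_cl h).
have hyu_le y : y \notin S i -> hy y + hu y <= #|R i :&: cl i y|.
  move=> yS.
  have dis : [disjoint [set w in Y :\: S i | H i y w] & [set w in U | H i y w]].
    rewrite disjoint_subset; apply/subsetP=> x; rewrite !inE.
    by case: (_ <= _); case: [forall _, _]; rewrite /= ?andbF.
  rewrite /hy /hu -card_setU_disjoint //.
  apply: subset_leq_card; apply/subsetP=> x hx.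
  have [h xS] : H i y x /\ x \notin S i.
    case/setUP: hx; rewrite inE => /andP[h1 h2]; split=> //.
      by case/setDP: h1.
    exact: U_S.
  by have := H_A h yS; rewrite !in_setI in_setU (negbTE xS).
have flip : \sum_(y in S i) hy y = \sum_(y in Y :\: S i) hs y.
  rewrite double_count; apply: eq_bigr => w _; apply: eq_card => y.
  by rewrite !inE Hsym.
rewrite (big_setID (S i)) /= (setIidPr SY).
have h1 : \sum_(y in S i) #|[set w | H i y w]| <=
    \sum_(y in S i) (hs y + hu y) + \sum_(y in Y :\: S i) hs y.
  rewrite -flip -big_split /=; apply: leq_sum => y _.
  by apply: leq_trans (split y) _; lia.
have h2 : 2 * (\sum_(y in S i) (hs y + hu y)) <= m * #|S i|.
  rewrite mulnC big_distrl /= mulnC -sum_nat_const; apply: leq_sum => y yS.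
  by apply: leq_trans (S_half yS); have := hs_le y; have := hu_le y; lia.
(* A vertex outside [S i] pays twice for its neighbours in [S i] and once for those in [R i]: at
   most [2 |S| + |R| <= m]. *)
have h3 : \sum_(y in Y :\: S i) #|[set w | H i y w]| +
    \sum_(y in Y :\: S i) hs y <= m * #|Y :\: S i|.
  rewrite mulnC -sum_nat_const -big_split /=.
  apply: leq_sum => y /setDP[yY yS]; apply: leq_trans (Hm i y).
  by have := split y; have := hyu_le y yS; have := hs_le y; lia.
have : #|Y| = #|S i| + #|Y :\: S i| by rewrite -(cardsID (S i) Y) (setIidPr SY).
nia.
Qed.

Lemma count_contradiction : False.
Proof.
pose At := [set v | t < #|miss v|].
have cAt : #|At| <= t.
  have : #|At| * t.+1 <= t ^ 2.
    apply: leq_trans Ht; rewrite -sum_nat_const [X in _ <= X](bigID (mem At)) /=.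
    apply: leq_trans _ (leq_addr _ _); apply: leq_sum => v; by rewrite inE.
  rewrite -mulnn; nia.
have YS : #|Y| <= t + \sum_i #|S i|.
  apply: leq_trans (_ : #|At :|: \bigcup_i S i| <= _).
    apply: subset_leq_card; apply/subsetP=> y; rewrite !inE negb_and -ltnNge.
    case/orP=> [->//|]; rewrite negb_forall => /existsP[i]; rewrite negbK => h.
    by apply/orP; right; apply/bigcupP; exists i.
  apply: leq_trans (leq_card_setU _ _) _; apply: leq_add => //.
  exact: leq_card_bigcup.
have h1 : N * #|Y| <= t ^ 2 + \sum_i \sum_(y in Y) #|[set w | H i y w]|.
  rewrite exchange_big /=; apply: leq_trans _ (leq_add Ht (leqnn _)).
  apply: leq_trans (_ : \sum_(y in Y) (#|miss y| +
     \sum_i #|[set w | H i y w]|) <= _).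
    rewrite mulnC -sum_nat_const; apply: leq_sum => y _.
    have := @cover_le setT xpredT y (fun _ _ _ _ => isT).
    rewrite cardsT => h; apply: leq_trans h _; rewrite leq_add2l.
    apply: leq_sum => i _; apply/eq_leq/eq_card => w; by rewrite !inE.
  rewrite big_split leq_add2r /= [X in _ <= X](bigID (mem Y)) /=.
  exact: leq_addr.
have h2 : 2 * (\sum_i \sum_(y in Y) #|[set w | H i y w]|) + m * \sum_i #|S i|
    <= k * (2 * m * #|Y|).
  rewrite !big_distrr -big_split -sum_nat_const; apply: leq_sum => i _.
  exact: charge.
(* Together these give [(2 N - 2 k m + m) |Y| <= 2 t^2 + m t <= 3 m t <= 6 t |Y|], using [t <= m]
   and [Y_large]. This contradicts [hN] and accounts for its term [6 * t]. *)
have := Y_large; rewrite -mulnn in h1.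
move: h1 h2 YS hN tm m0; clear.
move: (\sum_i \sum_(y in Y) _) (\sum_i #|S i|) #|Y| => a b y; nia.
Qed.

End Count.

(** * One-sided regularity *)

Definition rel_card (V : finType) (E : rel V) : nat := #|[set p : V * V | E p.1 p.2]|.

Definition edges (V : finType) (G : rel V) (A B : {set V}) : nat :=
  #|[set p in setX A B | G p.1 p.2]|.

(* Only sparseness violates this condition, unlike Szemeredi regularity.  Hence
   the area of the sparse ("dead") rectangles found so far is a potential that
   grows under refinement, and no energy increment is needed. *)
Definition thick (V : finType) (G : rel V) (e d : nat) (A B : {set V}) : bool :=
  [forall P : {set V}, forall Q : {set V},
    [&& P \subset A, Q \subset B, #|A| <= e * #|P| & #|B| <= e * #|Q|] ==>
    (#|P| * #|Q| <= d * edges G P Q)].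

(** Partitions are encoded as maps to a finite type of cells; cells may be empty. *)
Definition fiber (V T : finType) (f : V -> T) (a : T) : {set V} :=
  [set v | f v == a].

Definition pull (V T : finType) (f : V -> T) (r : rel T) : rel V :=
  fun v w => r (f v) (f w).

Lemma rel_card_pull (V T : finType) (f : V -> T) (r : rel T) :
  rel_card (pull f r) =
  \sum_(p : T * T | r p.1 p.2) #|fiber f p.1| * #|fiber f p.2|.
Proof.
rewrite /rel_card -sum1_card.
rewrite (partition_big (fun p => (f p.1, f p.2)) (fun p => r p.1 p.2)) /=; last first.
  by move=> p; rewrite inE.
apply: eq_bigr => -[a b] /= rab; rewrite sum1_card -cardsX.
apply: eq_card => -[v w]; rewrite !inE /= /pull.
rewrite -[in LHS]topredE /= inE /= xpair_eqE; case: eqP => [->|]; rewrite ?andbF //=.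
by case: eqP => [->|]; rewrite ?andbF // rab.
Qed.

(** Each bad pair has a sparse witness rectangle filling at least [1 / e^2] of it. Cutting every
    cell along all the witnesses makes these rectangles unions of cell pairs, which are then
    declared dead. *)
Lemma sparse_refinement (V T : finType) (G : rel V) (e d : nat)
    (f : V -> T) (dead : rel T) :
  d * rel_card (fun v w => G v w && pull f dead v w) <= rel_card (pull f dead) ->
  let bad a b := ~~ dead a b && ~~ thick G e d (fiber f a) (fiber f b) in
  exists (T' : finType) (f' : V -> T') (dead' : rel T'),
  [/\ #|T'| = #|T| * (2 ^ #|T| * 2 ^ #|T|),
    d * rel_card (fun v w => G v w && pull f' dead' v w) <= rel_card (pull f' dead')
  & e ^ 2 * rel_card (pull f dead) + rel_card (pull f bad)
      <= e ^ 2 * rel_card (pull f' dead')].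
Proof.
move=> hd bad.
have wit p : exists PQ : {set V} * {set V}, bad p.1 p.2 ->
    [/\ PQ.1 \subset fiber f p.1, PQ.2 \subset fiber f p.2,
      #|fiber f p.1| <= e * #|PQ.1|, #|fiber f p.2| <= e * #|PQ.2|
    & d * edges G PQ.1 PQ.2 <= #|PQ.1| * #|PQ.2|].
  case: (boolP (bad p.1 p.2)) => [|_]; last by exists (set0, set0).
  case/andP=> _; rewrite negb_forall => /existsP[P].
  rewrite negb_forall => /existsP[Q]; rewrite negb_imply -ltnNge.
  by case/andP=> /and4P[h1 h2 h3 h4] /ltnW h5; exists (P, Q).
have [PQ hPQ] := fin_all_exists wit.
(* The bits record in which witnesses [v] lies, on the first and on the second side. *)
pose bits1 v := [ffun b => v \in (PQ (f v, b)).1].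
pose bits2 v := [ffun a => v \in (PQ (a, f v)).2].
pose f' v : T * ({ffun T -> bool} * {ffun T -> bool}) := (f v, (bits1 v, bits2 v)).
pose dead' (x y : T * ({ffun T -> bool} * {ffun T -> bool})) :=
  dead x.1 y.1 || [&& bad x.1 y.1, x.2.1 y.1 & y.2.2 x.1].
exists _, f', dead'.
have dE v w : pull f' dead' v w = pull f dead v w ||
   (bad (f v) (f w) && ((v, w) \in setX (PQ (f v, f w)).1 (PQ (f v, f w)).2)).
  by rewrite /pull /dead' /f' /= !ffunE inE.
pose new v w := bad (f v) (f w) &&
  ((v, w) \in setX (PQ (f v, f w)).1 (PQ (f v, f w)).2).
have splitE (F : rel V) :
    rel_card (fun v w => F v w && pull f' dead' v w) =
    rel_card (fun v w => F v w && pull f dead v w) +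
    rel_card (fun v w => F v w && new v w).
  rewrite /rel_card -[LHS](cardsID [set p | pull f dead p.1 p.2]); congr addn.
    apply: eq_card => -[v w]; rewrite !inE /= dE.
    by case: (F v w); case: (pull f dead v w); rewrite ?andbF.
  apply: eq_card => -[v w]; rewrite !inE /= dE /new.
  case: (F v w); rewrite /= ?andbF //.
  rewrite /bad /pull; case: (dead _ _) => //=.
have newE (F : rel V) : rel_card (fun v w => F v w && new v w) =
    \sum_(p | bad p.1 p.2) edges F (PQ p).1 (PQ p).2.
  rewrite /rel_card -sum1_card.
  rewrite (partition_big (fun p => (f p.1, f p.2)) (fun p => bad p.1 p.2)) /=; last first.
    by move=> p; rewrite inE /new => /andP[_ /andP[]].
  apply: eq_bigr => -[a b] /= hb; rewrite sum1_card.
  have [/subsetP h1 /subsetP h2 _ _ _] := hPQ (a, b) hb.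
  apply: eq_card => -[v w]; rewrite !inE /= -[in LHS]topredE /= inE /= /new xpair_eqE.
  apply/idP/idP.
    case/andP=> /andP[-> /andP[_ h]] /andP[/eqP ea /eqP eb].
    by move: h; rewrite ea eb inE /= => ->.
  case/andP=> /andP[hv hw] ->.
  have := h1 _ hv; have := h2 _ hw; rewrite !inE /= => /eqP -> /eqP ->.
  by rewrite hb hv hw !eqxx.
have rT (F F' : rel V) : F =2 F' -> rel_card F = rel_card F'.
  by move=> h; apply: eq_card => p; rewrite !inE h.
have aT (F : rel V) : rel_card F = rel_card (fun v w => true && F v w).
  exact: rT.
split.
- by rewrite !card_prod !card_ffun card_bool.
- rewrite splitE [in X in _ <= X]aT splitE mulnDr leq_add //.
  rewrite !newE big_distrr /=; apply: leq_sum => p hb.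
  have [_ _ _ _ h] := hPQ p hb; apply: leq_trans h _.
  by rewrite -cardsX /edges; apply: eq_leq; apply: eq_card => q; rewrite !inE andbT.
- rewrite [in X in _ <= X]aT splitE mulnDr -aT leq_add2l rel_card_pull newE.
  rewrite big_distrr /=; apply: leq_sum => p hb.
  have [_ _ h1 h2 _] := hPQ p hb.
  have -> : edges (fun _ _ => true) (PQ p).1 (PQ p).2 = #|(PQ p).1| * #|(PQ p).2|.
    by rewrite -cardsX /edges; apply: eq_card => q; rewrite !inE andbT.
  by apply: leq_trans (leq_mul h1 h2) _; rewrite -mulnn; lia.
Qed.

(** [j] counts refinements, starting from one cell with nothing dead. While the bad area exceeds
    [|V|^2 / d], each refinement adds more than [|V|^2 / (d e^2)] to the dead area. *)
Lemma partition_potential (e d j : nat) : 0 < d -> 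
  exists M, forall (V : finType) (G : rel V),
  exists (T : finType) (f : V -> T) (dead : rel T),
  let bad a b := ~~ dead a b && ~~ thick G e d (fiber f a) (fiber f b) in
  [/\ #|T| <= M,
    d * rel_card (fun v w => G v w && pull f dead v w) <= rel_card (pull f dead)
  & d * rel_card (pull f bad) <= #|V| ^ 2 \/
    j * #|V| ^ 2 <= d * e ^ 2 * rel_card (pull f dead)].
Proof.
move=> d0; elim: j => [|j [M hM]].
  exists 1 => V G; exists unit, (fun=> tt), (fun _ _ => false).
  split; rewrite ?card_unit //; last by right.
  rewrite (_ : rel_card (fun v w => _ && _) = 0) ?muln0 //.
  by apply: eq_card0 => p; rewrite inE andbF.
exists (M * (2 ^ M * 2 ^ M)) => V G.
have [T [f [dead /= [hT hd hp]]]] := hM V G.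
have MM : M <= M * (2 ^ M * 2 ^ M).
  by rewrite leq_pmulr // muln_gt0 expn_gt0.
set bad := fun _ _ => _ in hp.
case: (leqP (d * rel_card (pull f bad)) (#|V| ^ 2)) => hb.
  by exists T, f, dead; split; [exact: leq_trans MM | | left].
case: hp => [hp|hp]; first by rewrite leqNgt hb in hp.
have [T' [f' [dead' [cT' hd' hp']]]] := @sparse_refinement V T G e d f dead hd.
exists T', f', dead'; split=> //.
  by rewrite cT' leq_mul // leq_mul // leq_pexp2l.
right; rewrite -/bad in hp'; move: hp hp' hb; clear.
move: (rel_card _) (rel_card _) (rel_card _) (e ^ 2) (#|V| ^ 2) => a b c E N.
nia.
Qed.

Theorem one_sided_regularity (e d : nat) : 0 < d ->
  exists M, 0 < M /\ forall (V : finType) (G : rel V), symmetric G ->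
  exists (T : finType) (f : V -> T) (Gam : rel T),
  [/\ #|T| <= M, symmetric Gam,
    forall a b, Gam a b -> thick G e d (fiber f a) (fiber f b) /\
       #|V| <= M * #|fiber f a|
  & d * rel_card (fun v w => G v w && ~~ pull f Gam v w) <= 8 * #|V| ^ 2].
Proof.
move=> d0.
(* The dead area never exceeds [|V|^2], so [d e^2 + 1] rounds exclude the second alternative. *)
have [M hM] := partition_potential e (d * e ^ 2).+1 d0.
exists (d * M).+1; split=> // V G Gs.
have [V0|V0] := posnP #|V|.
  exists unit, (fun=> tt), (fun _ _ => false); split=> //.
    by rewrite card_unit.
  rewrite (_ : rel_card _ = 0) ?muln0 //; apply/eqP; rewrite cards_eq0.
  by apply/eqP/setP=> -[v w]; have := card0_eq V0 v; rewrite inE.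
have [T [f [dead /= [hT hd hp]]]] := hM V G.
set bad := fun _ _ => _ in hp.
have dead_le : rel_card (pull f dead) <= #|V| ^ 2.
  by rewrite -mulnn -card_prod /rel_card max_card.
have {}hp : d * rel_card (pull f bad) <= #|V| ^ 2.
  case: hp => // hp; exfalso; have V2 : 0 < #|V| ^ 2 by rewrite expn_gt0 V0.
  move: hp dead_le V2; clear.
  move: (rel_card _) (d * e ^ 2) (#|V| ^ 2) => r D N; nia.
pose small a := d * M * #|fiber f a| < #|V|.
have small_le : d * #|[set v | small (f v)]| <= #|V|.
  have -> : #|[set v | small (f v)]| = \sum_(a | small a) #|fiber f a|.
    rewrite -sum1_card (partition_big f small) /=; last by move=> v; rewrite inE.
    apply: eq_bigr => a sa; rewrite sum1_card; apply: eq_card => v.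
    rewrite !inE -[in LHS]topredE /= inE; by case: eqP => [->|]; rewrite ?andbF ?sa.
  have M0 : 0 < M.
    by apply: leq_trans hT; case/card_gt0P: V0 => v _; apply/card_gt0P; exists (f v).
  rewrite -(leq_pmul2l M0) mulnA big_distrr /=.
  apply: leq_trans (_ : \sum_(a : T) #|V| <= _); last first.
    by rewrite sum_nat_const leq_mul2r hT orbT.
  rewrite [X in _ <= X](bigID small) /=; apply: leq_trans _ (leq_addr _ _).
  by apply: leq_sum => a /ltnW; rewrite (mulnC M).
(* Discarded are the dead pairs, the bad pairs, and those with a small first or second cell: four
   losses of at most [|V|^2 / d]. Requiring [ok] in both orders makes [Gam] symmetric and doubles
   this to eight. *)
pose ok a b := [&& ~~ dead a b, thick G e d (fiber f a) (fiber f b), ~~ small a & ~~ small b].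
exists T, f, (fun a b => ok a b && ok b a); split.
- by apply: leq_trans hT _; rewrite leqW // leq_pmull.
- by move=> a b; rewrite andbC.
- move=> a b /andP[/and4P[_ h1 h2 _] _]; split=> //.
  by move: h2; rewrite /small -leqNgt => h; apply: leq_trans h _; rewrite leq_mul2r leqnSn orbT.
- pose L (F : rel V) := [set p : V * V | F p.1 p.2].
  pose lost := L (fun v w => G v w && ~~ pull f ok v w).
  have lost_le : d * #|lost| <= 4 * #|V| ^ 2.
    have : #|lost| <= rel_card (fun v w => G v w && pull f dead v w)
       + rel_card (pull f bad) + #|setX [set v | small (f v)] [set: V]|
       + #|setX [set: V] [set v | small (f v)]|.
      rewrite /rel_card.
      do 3 (apply: leq_trans _ (leq_add (leq_card_setU _ _) (leqnn _)) ||
            apply: leq_trans _ (leq_add (leq_add (leq_card_setU _ _) (leqnn _)) (leqnn _)) ||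
            apply: leq_trans _ (leq_card_setU _ _)).
      apply: subset_leq_card; apply/subsetP=> -[v w]; rewrite !inE /= !andbT.
      rewrite /pull /ok /bad /small; case: (G v w) => //=.
      case: (dead _ _) => //=; case: (thick _ _ _ _ _) => //=.
      by rewrite negb_and !negbK.
    rewrite !cardsX cardsT; move: hd hp small_le dead_le; clear; rewrite -!mulnn.
    move: #|lost| (rel_card _) (rel_card _) (rel_card _) => a b c g.
    move: #|_| => s; nia.
  have : rel_card (fun v w => G v w && ~~ pull f (fun a b => ok a b && ok b a) v w)
       <= #|lost| + #|lost|.
    pose sw (p : V * V) := (p.2, p.1).
    have swI : injective sw by move=> [a b] [c g] [-> ->].
    rewrite -{2}(card_imset lost swI) /rel_card.
    apply: leq_trans _ (leq_card_setU _ _).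
    apply: subset_leq_card; apply/subsetP=> -[v w]; rewrite !inE /= /pull negb_and.
    case/andP=> gvw /orP[h|h]; first by rewrite gvw h.
    apply/orP; right; apply/imsetP; exists (w, v) => //.
    by rewrite inE /= Gs gvw.
  move: lost_le; clear; move: (rel_card _) #|lost| (#|V| ^ 2) => a b N; nia.
Qed.

(** * Cycles through thick pairs *)

Lemma edges_sum (V : finType) (G : rel V) (A B : {set V}) :
  edges G A B = \sum_(a in A) #|[set b in B | G a b]|.
Proof.
rewrite /edges -sum1_card (partition_big fst (mem A)) /=; last first.
  by move=> p; rewrite !inE => /andP[/andP[]].
apply: eq_bigr => a aA; rewrite sum1_card.
rewrite -(card_imset [set b in B | G a b] (_ : injective (pair a))); last by move=> x y [].
apply: eq_card => -[x y]; rewrite -[in LHS]topredE /= !inE /=.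
apply/idP/imsetP.
  by case/andP=> /andP[/andP[_ yB] xy] /eqP ea; subst x; exists y; rewrite ?inE ?yB.
by case=> z; rewrite inE => /andP[zB az] [-> ->]; rewrite aA zB az eqxx.
Qed.

Lemma thick_degree (V : finType) (G : rel V) e d (A B P Q : {set V}) :
  thick G e d A B -> P \subset A -> Q \subset B -> P != set0 ->
  #|A| <= e * #|P| -> #|B| <= e * #|Q| ->
  exists2 x, x \in P & #|Q| <= d * #|[set y in Q | G x y]|.
Proof.
move=> /forallP/(_ P)/forallP/(_ Q)/implyP h PA QB P0 hA hB.
have {h} := h _; rewrite PA QB hA hB => /(_ isT) h.
apply/exists_inP; apply: contraLR h; rewrite negb_exists_in => /forall_inP h.
rewrite -ltnNge edges_sum big_distrr /= -sum_nat_const.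
have /set0Pn[x xP] := P0.
rewrite (bigD1 x) //= [X in _ < X](bigD1 x) //= -addSn leq_add //.
  by rewrite ltnNge h.
by apply: leq_sum => y /andP[yP _]; rewrite ltnW // ltnNge h.
Qed.

(** * Greedy embedding along a closed walk of cells *)

Section Greedy.
Variables (V T : finType) (G : rel V) (f : V -> T) (Gam : rel T) (q d : nat).
Hypothesis Gsym : symmetric G.
Hypothesis Girr : irreflexive G.
Hypothesis Gamsym : symmetric Gam.
Hypothesis d0 : 0 < d.
Hypothesis Gthick :
  forall a b, Gam a b -> thick G (q * d) d (fiber f a) (fiber f b).

Let nb v b := [set w in fiber f b | G v w].
(* The end [v] of a path with forbidden vertices [Z] can be continued into [b]. *)
Let good v b (Z : {set V}) := #|fiber f b| <= q * d * #|nb v b :\: Z|.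

Let good_ext v b (Z Z' : {set V}) : good v b Z -> Z =i Z' -> good v b Z'.
Proof. by move=> h /setP <-. Qed.

Let nonempty (A B : {set V}) (c : nat) : 0 < #|A| -> #|A| <= c * #|B| -> B != set0.
Proof. by move=> A0 h; rewrite -card_gt0; nia. Qed.

(** The free neighbours of [v] fill [1 / (q d)] of cell [b], and the free vertices fill [1 / q] of
    cell [c]. By thickness one of the former sees [1 / d] of the latter, so the new end is [good]
    again. *)
Let greedy_step v b c (Z : {set V}) : good v b Z -> Gam b c -> 0 < #|fiber f b| ->
  #|fiber f c| <= q * #|fiber f c :\: Z| ->
  exists y, [/\ y \in fiber f b, y \notin Z, G v y & good y c (y |: Z)].
Proof.
move=> gv bc b0 hc.
have [||||| y] := @thick_degree _ _ _ _ _ _ (nb v b :\: Z) (fiber f c :\: Z) (Gthick bc).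
- by apply: subset_trans (subsetDl _ _) _; apply/subsetP=> x; rewrite inE => /andP[].
- exact: subsetDl.
- exact: nonempty gv.
- exact: gv.
- by apply: leq_trans hc _; nia.
rewrite !inE => /and3P[yZ yb vy] hy; exists y; split=> //; first by rewrite inE.
rewrite /good (_ : nb y c :\: _ = [set z in fiber f c :\: Z | G y z]).
  by apply: leq_trans hc _; rewrite -mulnA leq_mul2l hy orbT.
apply/setP=> x; rewrite !inE negb_or.
have [->|_] := eqVneq x y; first by rewrite Girr !andbF.
by case: (x \in Z); case: (f x == c).
Qed.

(** The vertices lag one cell behind the walk: the last cell is only reserved as the next one to
    enter. The counting hypothesis keeps [1 / q] of each cell free after all visits. *)
Lemma greedy_path t b v (Z : {set V}) : good v b Z -> path Gam b t ->
  {in b :: t, forall c, 0 < #|fiber f c|} ->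
  {in t, forall c, #|fiber f c| + q * count_mem c (b :: t) <= q * #|fiber f c :\: Z|} ->
  exists vs, [/\ path G v vs, size vs = size t, uniq vs, all [predC Z] vs
    & good (last v vs) (last b t) (Z :|: [set x in vs])].
Proof.
elim: t b v Z => [|c t IH] b v Z gv /=.
  move=> _ _ _; exists [::]; split=> //; apply: (good_ext gv) => x.
  by rewrite !inE orbF.
case/andP=> bc pt h0 hcnt.
have [||y [yb yZ vy gy]] := @greedy_step v b c Z gv bc.
- by apply: h0; rewrite mem_head.
- by apply: leq_trans (hcnt c _); rewrite ?mem_head // leq_addr.
have [||vs [p1 p2 p3 p4 p5]] := IH _ _ _ gy pt.
- by move=> z zt; apply: h0; rewrite inE zt orbT.
- move=> z zt; have := hcnt z; rewrite inE zt orbT => /(_ isT) /=.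
  have : #|fiber f z :\: Z| <= (b == z) + #|fiber f z :\: (y |: Z)|.
    move: yb; rewrite inE => /eqP yb.
    case: (boolP (b == z)) => [/eqP ez|nbz].
      rewrite (cardsD1 y (_ :\: Z)); apply: leq_add; first by case: (y \in _).
      by apply: subset_leq_card; apply/subsetP=> x; rewrite !inE negb_or -andbA.
    apply: subset_leq_card; apply/subsetP=> x; rewrite !inE negb_or.
    case/andP=> -> /eqP fx; rewrite fx eqxx !andbT; apply: contra nbz => /eqP ex.
    by rewrite -fx ex yb.
  move: #|_| (_ + count_mem z t) => *; nia.
exists (y :: vs); split=> /=.
- by rewrite vy.
- by rewrite p2.
- rewrite p3 andbT; apply/negP=> /(allP p4); by rewrite !inE eqxx.
- rewrite yZ; apply: sub_all p4 => x; by rewrite !inE negb_or => /andP[].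
- by apply: (good_ext p5) => x; rewrite !inE orbCA orbA.
Qed.

(** The first vertex [v0] is chosen with many neighbours in both the second cell and the last one.
    In the counting hypothesis the quotient plus [2] pays for [v0] and for the set reserved in the
    last cell, whose size is the quotient rounded up. *)
Lemma cycle_from_closed_walk s : 2 < q -> 2 < size s -> cycle Gam s ->
  {in s, forall c, q * d <= #|fiber f c|} ->
  {in s, forall c, #|fiber f c| + q * (count_mem c s + #|fiber f c| %/ (q * d) + 2)
     <= q * #|fiber f c|} ->
  exists vs, [/\ cycle G vs, uniq vs & size vs = size s].
Proof.
case: s => [|a0 [|a1 s]] // q2 s2 hs hlarge hcnt.
case/lastP: s => [|t z] // in s2 hs hlarge hcnt *.
move: hs; rewrite /= !rcons_path last_rcons => /andP[a01 /andP[/andP[pt tz] za]].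
have qd0 : 0 < q * d by nia.
have pos c : c \in [:: a0, a1 & rcons t z] -> 0 < #|fiber f c|.
  by move=> /hlarge; apply: leq_trans.
have zs : z \in [:: a0, a1 & rcons t z] by rewrite !inE mem_rcons mem_head !orbT.
have a0s : a0 \in [:: a0, a1 & rcons t z] by rewrite mem_head.
have a1s : a1 \in [:: a0, a1 & rcons t z] by rewrite !inE eqxx orbT.
(* Vertices of the first cell with too few neighbours in [c]; by thickness they fill less than
   [1 / (q d)] of it. *)
pose F c := [set v in fiber f a0 | d * #|nb v c| < #|fiber f c|].
have cF c : Gam a0 c -> c \in [:: a0, a1 & rcons t z] -> q * d * #|F c| < #|fiber f a0|.
  move=> ac cs; rewrite ltnNge; apply/negP=> h.
  have [||||| x] := @thick_degree _ _ _ _ _ _ (F c) (fiber f c) (Gthick ac).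
  - by apply/subsetP=> x; rewrite inE => /andP[].
  - exact: subxx.
  - by apply: nonempty h; exact: pos.
  - exact: h.
  - by rewrite leq_pmull.
  by rewrite inE => /andP[_]; rewrite ltnNge => /negbTE ->.
have hU : #|F a1 :|: F z| <= #|F a1| + #|F z| by exact: leq_card_setU.
have /set0Pn[v0] : fiber f a0 :\: (F a1 :|: F z) != set0.
  rewrite setD_eq0; apply/negP=> /subset_leq_card.
  have := cF a1 a01 a1s; have := cF z; rewrite Gamsym => /(_ za zs).
  move: hU; move: #|_| #|_| #|_| #|_| => *; nia.
rewrite in_setD in_setU negb_or => /andP[/andP[v1 vz] v0a].
have {}v1 : #|fiber f a1| <= d * #|nb v0 a1| by move: v1; rewrite inE v0a -leqNgt.
have {}vz : #|fiber f z| <= d * #|nb v0 z| by move: vz; rewrite inE v0a -leqNgt.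
(* A small part [K] of the neighbourhood of the first vertex is kept aside to
   close the cycle. *)
pose kz := (#|fiber f z| %/ (q * d)).+1.
have kz1 : kz <= #|nb v0 z|.
  have := leq_trunc_div #|fiber f z| (q * d); have := pos z zs.
  rewrite /kz; move: (_ %/ _) => r; nia.
have kz2 : #|fiber f z| <= q * d * kz.
  by rewrite [_ * kz]mulnC; apply: ltnW; rewrite /kz ltn_ceil.
have kz3 : q * d * kz <= #|fiber f z| + q * d.
  by rewrite /kz mulnS addnC leq_add2r [_ * (_ %/ _)]mulnC leq_trunc_div.
have [K KN cK] : exists2 K : {set V}, K \subset nb v0 z & #|K| = kz.
  exists [set x in take kz (enum (nb v0 z))].
    by apply/subsetP=> x; rewrite inE => /mem_take; rewrite mem_enum.
  rewrite cardsE; have /card_uniqP -> := take_uniq kz (enum_uniq (mem (nb v0 z))).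
  by rewrite size_takel // -cardE.
pose Z0 := v0 |: K.
have Kz x : x \in K -> f x = z /\ G v0 x.
  by move/(subsetP KN); rewrite !inE => /andP[/eqP].
have cDZ c : c \in [:: a0, a1 & rcons t z] ->
    #|fiber f c| <= #|fiber f c :\: Z0| + (#|fiber f c| %/ (q * d) + 2).
  move=> cs; rewrite -{1}(cardsID Z0 (fiber f c)) addnC leq_add2l.
  apply: leq_trans (_ : #|[set v0]| + #|fiber f c :&: K| <= _).
    apply: leq_trans (leq_card_setU _ _); apply: subset_leq_card.
    by apply/subsetP=> x; rewrite !inE => /andP[-> /=].
  rewrite cards1; have [->|cz] := eqVneq c z.
    by have := subset_leq_card (subsetIr (fiber f z) K); rewrite cK /kz; lia.
  rewrite (_ : _ :&: K = set0) ?cards0; first by rewrite addn2.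
  apply/setP=> x; rewrite !inE; apply/negbTE/negP=> /andP[/eqP fx /Kz[fz _]].
  by rewrite -fx fz eqxx in cz.
have g0 : good v0 a1 Z0.
  have : #|nb v0 a1| <= #|nb v0 a1 :\: Z0| + kz.
    rewrite -(cardsID Z0) addnC leq_add2l -cK; apply: subset_leq_card.
    apply/subsetP=> x; rewrite !inE => /andP[/andP[_ vx]] /orP[/eqP e|//].
    by rewrite e Girr in vx.
  (* If the second and last cells coincide, [K] also takes neighbours away from the path. Here
     [2 < q] leaves room: [3 |z|] minus [|z| + q d], which is at most [2 |z|]. *)
  have [e|nz] := eqVneq a1 z.
    rewrite -e in kz3; move=> hD; rewrite /good.
    have h1 : q * #|fiber f a1| <= q * d * #|nb v0 a1|.
      by rewrite -mulnA leq_mul2l v1 orbT.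
    have h2 : q * d * #|nb v0 a1| <= q * d * #|nb v0 a1 :\: Z0| + q * d * kz.
      by rewrite -mulnDr leq_mul2l hD orbT.
    have h3 : 3 * #|fiber f a1| <= q * #|fiber f a1| by rewrite leq_mul2r q2 orbT.
    have := hlarge _ a1s; lia.
  move=> _; rewrite /good (_ : nb v0 a1 :\: Z0 = nb v0 a1).
    by apply: leq_trans v1 _; nia.
  apply/setP=> x; rewrite !inE; have [->|_] := eqVneq x v0.
    by rewrite Girr !andbF.
  case: (boolP (x \in K)) => //= /Kz[-> _]; by rewrite eq_sym (negbTE nz).
have [|| vs [p1 p2 p3 p4 p5]] := greedy_path g0 pt.
- move=> c ct; apply: pos; move: ct; rewrite !inE mem_rcons inE.
  by case/orP=> ->; rewrite ?orbT.
- move=> c ct.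
  have cs : c \in [:: a0, a1 & rcons t z] by rewrite !inE mem_rcons inE ct !orbT.
  have h1 := hcnt c cs; have := leq_mul (leqnn q) (cDZ c cs).
  have : count_mem c (a1 :: t) <= count_mem c [:: a0, a1 & rcons t z].
    by rewrite /= -cats1 count_cat addnCA leq_add2l addnCA leq_addr.
  move/(leq_mul (leqnn q)); move: h1; clear; move: (_ %/ _) => r.
  rewrite !mulnDr; lia.
set Z := Z0 :|: [set x in vs] in p5.
have ls : last a1 t \in [:: a0, a1 & rcons t z].
  have := mem_last a1 t; rewrite !inE mem_rcons inE.
  by case/orP=> ->; rewrite ?orbT.
have [||||| y] := @thick_degree _ _ _ _ _ _ (nb (last v0 vs) (last a1 t) :\: Z) K (Gthick tz).
- by apply: subset_trans (subsetDl _ _) _; apply/subsetP=> x; rewrite inE => /andP[].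
- by apply/subsetP=> x /Kz[]; rewrite inE => ->.
- by apply: nonempty p5; exact: pos.
- exact: p5.
- by rewrite cK.
rewrite !inE !negb_or => /andP[/andP[/andP[yv0 yK] yvs] /andP[_ gy]] hy.
have /card_gt0P[x] : 0 < #|[set x in K | G y x]|.
  by rewrite lt0n; apply/eqP=> e; rewrite e muln0 cK in hy.
rewrite inE => /andP[xK yx].
exists (v0 :: rcons (rcons vs y) x); split.
- by rewrite /= !rcons_path !last_rcons p1 gy yx Gsym; case: (Kz x xK).
- rewrite /= !rcons_uniq !(mem_rcons, inE) !negb_or p3 yvs (eq_sym v0 y) yv0 !andbT /=.
  have xv0 : v0 != x by apply/eqP=> e; case: (Kz x xK) => _; rewrite -e Girr.
  have yx' : x != y by apply: contraNneq yK => <-.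
  rewrite xv0 yx' /=; apply/andP; split; apply/negP=> /(allP p4) /=; rewrite !inE.
    by rewrite eqxx.
  by rewrite xK orbT.
- by rewrite /= !size_rcons p2.
Qed.

End Greedy.

(** * Closed walks with controlled numbers of visits *)

Section ClosedWalk.
Variables (T : finType) (Gam : rel T).
Hypothesis Gamsym : symmetric Gam.

(** The detour from [a] to [b] and back is inserted at a visit to [a]. Using [perm_eq] keeps track
    of how often each cell is visited. *)
Lemma closed_walk_insert s a b : cycle Gam s -> a \in s -> Gam a b ->
  exists2 s', cycle Gam s' & perm_eq s' (a :: b :: s).
Proof.
move=> cs /rot_to[i s1 e] ab; exists (a :: b :: a :: s1).
  move: cs; rewrite -(rot_cycle i) e /= => ->.
  by rewrite ab Gamsym ab.
by rewrite -e !perm_cons perm_rot.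
Qed.

Lemma closed_walk_insert_seq s (l : seq (T * T)) : cycle Gam s ->
  all (fun p => (p.1 \in s) && Gam p.1 p.2) l ->
  exists2 s', cycle Gam s' & perm_eq s' (map fst l ++ map snd l ++ s).
Proof.
move=> cs; elim: l => [|[a b] l IH] /=; first by exists s.
case/andP=> /andP[as_ ab] /IH[s1 c1 p1].
have [|s2 c2 p2] := @closed_walk_insert s1 a b c1 _ ab.
  by rewrite (perm_mem p1) !mem_cat as_ !orbT.
exists s2 => //; apply: perm_trans p2 _; rewrite perm_cons.
by rewrite perm_sym (perm_catCA _ [:: b]) /= perm_cons perm_sym.
Qed.

Lemma closed_walk_path s a p : cycle Gam s -> a \in s -> path Gam a p ->
  exists s', [/\ cycle Gam s', {subset s <= s'}, {subset p <= s'}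
    & size s' = size s + 2 * size p].
Proof.
elim: p s a => [|b p IH] s a cs as_ /=.
  by exists s; split=> //; rewrite muln0 addn0.
case/andP=> ab pp; have [s1 c1 p1] := closed_walk_insert cs as_ ab.
have [|s2 [c2 ss2 ps2 z2]] := IH s1 b c1 _ pp.
  by rewrite (perm_mem p1) !inE eqxx orbT.
exists s2; split=> //.
- by move=> x xs; apply: ss2; rewrite (perm_mem p1) !inE xs !orbT.
- move=> x; rewrite inE => /predU1P[->|]; last exact: ps2.
  by apply: ss2; rewrite (perm_mem p1) !inE eqxx orbT.
- by rewrite z2 (perm_size p1) /=; lia.
Qed.

(** Each cell of the component is reached by a simple path walked to and fro, which keeps the length
    even and costs at most [2 |T|]. *)
Lemma closed_walk_cover a b : Gam a b ->
  exists s j, [/\ cycle Gam s, forall c, connect Gam a c -> c \in s,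
    size s = j.+1.*2 & j <= #|T| ^ 2].
Proof.
move=> ab.
suff [s [j [cs sub zs hj]]] : exists s j, [/\ cycle Gam s,
    {subset a :: [seq c <- enum T | connect Gam a c] <= s},
    size s = j.+1.*2 & j <= #|T| * size (enum T)].
  exists s, j; split=> //; last by rewrite -mulnn {2}cardE.
  by move=> c ac; apply: sub; rewrite inE mem_filter ac mem_enum orbT.
elim: (enum T) => [|c l [s [j [cs sub zs hj]]]].
  exists [:: a; b], 0; split=> //=; first by rewrite ab Gamsym ab.
  by move=> c; rewrite !inE => ->.
have as_ : a \in s by apply: sub; rewrite mem_head.
case: (boolP (connect Gam a c)) => ac; last first.
  by exists s, j; rewrite /= (negbTE ac); split=> //; rewrite (leq_trans hj) // leq_mul2l leqnSn orbT.
have [p pp] := connectP ac; case/shortenP: pp => p' pp' up' _ ec.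
have [s' [c1 ss ps z']] := closed_walk_path cs as_ pp'.
exists s', (j + size p'); split=> //=.
- move=> x; rewrite ac !inE => /or3P[/eqP->|/eqP->|xl].
  + exact: ss.
  + by rewrite ec; case/lastP: (p') ps as_ => [_ /ss //|q y ps _];
      rewrite last_rcons; apply: ps; rewrite mem_rcons mem_head.
  + by apply: ss; apply: sub; rewrite inE xl orbT.
- by rewrite z' zs; lia.
- have : size (a :: p') <= #|T| by rewrite -(card_uniqP up') max_card.
  by rewrite /= mulnS => /ltnW h1; rewrite addnC leq_add.
Qed.

End ClosedWalk.

Lemma count_mem_flatten_nseq (C T : finType) (t : C -> nat) (h : C -> T) (a : T) :
  count_mem a (map h (flatten [seq nseq (t c) c | c <- enum C])) =
  \sum_(c | h c == a) t c.
Proof.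
rewrite count_map count_flatten -map_comp sumnE big_map big_enum /= [RHS]big_mkcond /=.
by apply: eq_bigr => c _; rewrite count_nseq /=; case: eqP => _; rewrite ?mul1n ?mul0n.
Qed.

(** Back-and-forth steps over the matched pairs enter cell [a] at most about [2 h |fiber f a| / |X|]
    times, since [X] and, by injectivity, its image under [g] each meet the cell at most
    [|fiber f a|] times. As [2 h <= n], a fraction [1 / p.+1] of the cell, that is [4 / q], stays
    free. *)
Theorem long_cycle (p d M : nat) : 0 < d -> exists n0,
  forall (V T : finType) (G : rel V) (f : V -> T) (Gam : rel T) (n : nat)
    (X : {set V}) (g : V -> V) (a0 : T),
  let q := 4 * p.+1 in
  symmetric G -> irreflexive G -> symmetric Gam -> #|T| <= M ->
  (forall a b, Gam a b -> thick G (q * d) d (fiber f a) (fiber f b) /\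
     #|V| <= M * #|fiber f a|) ->
  n0 <= n -> ~~ odd n -> n <= #|V| ->
  {in X &, injective g} ->
  {in X, forall x, Gam (f x) (f (g x)) /\ connect Gam a0 (f x)} ->
  p.+1 * n <= p * #|X| ->
  exists vs, [/\ cycle G vs, uniq vs & size vs = n].
Proof.
move=> d0; set q := 4 * p.+1.
(* [L] is [q] times the visits beyond the proportional share: the covering walk, rounding for at
   most [M] pairs on either side, and the [2] of [cycle_from_closed_walk]. *)
pose L := 4 * p.+1 * (2 * (M ^ 2).+1 + 2 * M + 2).
pose Q := L + q * d.
exists (M * Q + 2 * (M ^ 2).+1 + 3).
move=> V T G f Gam n X g a0 /= Gs Gi Gams TM hG hn on nV gI hX cX.
have X0 : 0 < #|X| by nia.
have /card_gt0P[x0 x0X] := X0.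
have [g0 cx0] := hX _ x0X.
have [s0 [j [cs0 sub0 zs0 hj]]] := closed_walk_cover Gams g0.
have {}hj : j <= M ^ 2 by apply: leq_trans hj _; rewrite leq_exp2r.
have csym : connect_sym Gam by exact: sym_connect_sym.
have sub x : x \in X -> f x \in s0.
  move=> xX; apply: sub0; have [_ cx] := hX x xX.
  by apply: connect_trans cx; rewrite csym.
(* Both [n] and the covering walk have even length, so the missing length consists of [h]
   back-and-forth steps. *)
pose h := n./2 - j.+1.
have hh : 2 * h + size s0 = n.
  rewrite zs0 /h -mul2n -mulnDr subnK ?mul2n ?even_halfK //.
  by rewrite -(leq_double) even_halfK // ; lia.
pose Xc (c : T * T) := [set x in X | (f x, f (g x)) == c].
(* The cell pair [c] is traversed about [#|Xc c| * h / #|X|] times, which spreads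
   the [h] back-and-forth steps proportionally to the matching. *)
pose t c := if Xc c == set0 then 0 else (#|Xc c| * h) %/ #|X| + 1.
pose l0 := flatten [seq nseq (t c) c | c <- enum {: T * T}].
(* Rounding up in [t] makes [l0] at least [h] long; it is cut to exactly [h] pairs. *)
pose l := take h l0.
have cXc : \sum_c #|Xc c| = #|X|.
  rewrite -[RHS]sum1_card (partition_big (fun x => (f x, f (g x))) xpredT) //=.
  by apply: eq_bigr => c _; rewrite -sum1_card; apply: eq_bigl => x; rewrite inE.
have sl0 : h <= size l0.
  rewrite size_flatten /shape -map_comp sumnE big_map big_enum /=.
  rewrite -(leq_pmul2l X0) -{1}cXc big_distrl big_distrr /=.
  apply: leq_sum => c _; rewrite size_nseq /t.
  case: eqVneq => [->|_]; first by rewrite cards0.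
  by rewrite addn1 mulnC [X in _ <= X]mulnC; apply: ltnW; rewrite (mulnC h) ltn_ceil.
have sl : size l = h by rewrite size_takel.
have lX c : c \in l -> exists2 x, x \in X & c = (f x, f (g x)).
  move/mem_take/flattenP=> [_ /mapP[c' _ ->]]; rewrite mem_nseq => /andP[tc /eqP ec].
  subst c'; move: tc; rewrite /t; case: eqVneq => // /set0Pn[x]; rewrite inE.
  by case/andP=> xX /eqP e _; exists x.
have [|s cs ps] := closed_walk_insert_seq Gams (l := l) cs0.
  by apply/allP=> c /lX[x xX ->] /=; rewrite sub //; case: (hX x xX).
have zs : size s = n.
  by rewrite (perm_size ps) !size_cat !size_map sl addnA addnn -mul2n.
have half (r : V -> T) (pr : T * T -> T) a : (forall x, pr (f x, f (g x)) = r x) ->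
    #|[set x in X | r x == a]| <= #|fiber f a| ->
    (#|[set c : T * T | pr c == a]| <= M) ->
    #|X| * count_mem a (map pr l) <= h * #|fiber f a| + M * #|X|.
  move=> er hr hM.
  have : count_mem a (map pr l) <= count_mem a (map pr l0).
    by rewrite -[l0](cat_take_drop h) map_cat count_cat leq_addr.
  rewrite count_mem_flatten_nseq => hc.
  apply: leq_trans (leq_mul (leqnn _) hc) _; rewrite big_distrr /=.
  apply: leq_trans (_ : \sum_(c | pr c == a) (h * #|Xc c| + #|X|) <= _).
    apply: leq_sum => c _; rewrite /t; case: eqVneq => _; first by rewrite muln0.
    by rewrite mulnDr muln1 leq_add2r mulnC (mulnC h) leq_trunc_div.
  rewrite big_split /= sum_nat_const leq_add //; last first.
    by rewrite leq_mul2r; apply/orP; right; move: hM; rewrite cardsE.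
  rewrite -big_distrr leq_mul2l; apply/orP; right; apply: leq_trans hr.
  rewrite -[X in _ <= X]sum1_card
    (partition_big (fun x => (f x, f (g x))) (fun c => pr c == a)) /=; last first.
    by move=> x; rewrite inE er => /andP[].
  apply: leq_sum => c pc; rewrite -sum1_card; apply: eq_leq; apply: eq_bigl => x.
  by rewrite !inE -er; case: eqP => [->|]; rewrite ?andbF ?pc ?andbT.
have cM (pr : T * T -> T) (i : T -> T -> T * T) a :
    (forall b, injective (i b)) -> (forall c, pr c == a -> exists b, c = i a b) ->
    #|[set c : T * T | pr c == a]| <= M.
  move=> iI hi; apply: leq_trans TM.
  rewrite -cardsT -(card_imset [set: T] (iI a)).
  apply: subset_leq_card; apply/subsetP=> c; rewrite inE => /hi[b ->].
  by rewrite imset_f.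
have count_s a : #|X| * p.+1 * count_mem a s <=
    #|X| * (p.+1 * (2 * (M ^ 2).+1 + 2 * M) + p * #|fiber f a|).
  have h1 : #|X| * count_mem a (map fst l) <= h * #|fiber f a| + M * #|X|.
    apply: (@half f) => //.
      by apply: subset_leq_card; apply/subsetP=> x; rewrite !inE => /andP[].
    apply: (@cM fst pair) => [b x y []//|[x y] /= /eqP ->]; by exists y.
  have h2 : #|X| * count_mem a (map snd l) <= h * #|fiber f a| + M * #|X|.
    apply: (@half (f \o g)) => //.
      rewrite -(card_in_imset (f := g)); last first.
        by move=> x y; rewrite !inE => /andP[xX _] /andP[yX _]; exact: gI.
      apply: subset_leq_card; apply/subsetP=> _ /imsetP[x] /[swap] ->.
      by rewrite !inE => /andP[].
    apply: (@cM snd (fun b a => (a, b))) => [b x y []//|[x y] /= /eqP ->]; by exists x.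
  have h3 : count_mem a s0 <= 2 * (M ^ 2).+1.
    by apply: leq_trans (count_size _ _) _; rewrite zs0 -mul2n leq_mul2l.
  rewrite (permP ps) !count_cat.
  have h4 : p.+1 * (2 * h) <= p * #|X|.
    by apply: leq_trans cX; rewrite leq_mul2l -hh leq_addr orbT.
  move: h1 h2 h3 h4; clear.
  move: (count_mem _ _) (count_mem _ _) (count_mem _ _) #|_| #|_| => c1 c2 c3 F x.
  move: (2 * (M ^ 2).+1) => K h1 h2 h3 h4.
  have := leq_mul (leqnn p.+1) (leq_add h1 h2).
  have := leq_mul h4 (leqnn F); have := leq_mul (leqnn (x * p.+1)) h3.
  lia.
have {}count_s a : p.+1 * count_mem a s <=
    p.+1 * (2 * (M ^ 2).+1 + 2 * M) + p * #|fiber f a|.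
  by rewrite -(leq_pmul2l X0) mulnA.
have large a : a \in s -> Q <= #|fiber f a|.
  move=> as_; have [b ab] : exists b, Gam a b.
    by exists (next s a); exact: next_cycle cs as_.
  have [_ hV] := hG _ _ ab.
  have : M * Q < M * #|fiber f a| by apply: leq_trans hV; apply: leq_trans nV; lia.
  by rewrite ltn_mul2l => /andP[_ /ltnW].
rewrite -zs; apply: (@cycle_from_closed_walk V T G f Gam q d) => //.
- by move=> a b /hG[].
- by rewrite /q; lia.
- by rewrite zs; lia.
- by move=> c /large; apply: leq_trans; rewrite leq_addl.
- move=> c /large; rewrite /Q => hc.
  have h1 : q * (#|fiber f c| %/ (q * d)) <= #|fiber f c|.
    apply: leq_trans (leq_trunc_div #|fiber f c| (q * d)).
    by rewrite mulnC leq_mul2l leq_pmulr // orbT.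
  have := count_s c; move: hc h1; rewrite /L /q; clear.
  move: (_ %/ _) => r; move: (count_mem c s) #|_| (M ^ 2).+1 => y F K.
  rewrite !mulnDr; lia.
Qed.

(** * Colourings without long monochromatic cycles *)

Theorem cycle_free_structure (p d : nat) : 0 < p -> 0 < d -> exists n0,
  forall (V : finType) (G : rel V) (n : nat),
  symmetric G -> irreflexive G -> n0 <= n -> ~~ odd n -> n <= #|V| ->
  (forall vs, cycle G vs -> uniq vs -> size vs = n -> False) ->
  exists (H : rel V) (comp : V -> nat) (S R : {set V}),
  [/\ [/\ symmetric H, (forall v w, H v w -> comp v = comp w),
      (forall v w, H v w -> [\/ v \in S, w \in S | (v \in R) && (w \in R)])
    & [disjoint S & R]],
    (forall v, 2 * #|S :&: [set w | comp w == comp v]| +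
         #|R :&: [set w | comp w == comp v]| <= (p.+1 * n) %/ p)
  & d * rel_card (fun v w => G v w && ~~ H v w) <= 8 * #|V| ^ 2].
Proof.
move=> p0 d0; have [M [M0 hreg]] := one_sided_regularity (4 * p.+1 * d) d0.
have [n0 hcyc] := long_cycle p M d0.
exists n0 => V G n Gs Gi hn on nV nocyc.
have [T [f [Gam [TM Gams hG lost]]]] := hreg V G Gs.
set m := (_ %/ _).
pose H := pull f Gam.
have Hs : symmetric H by move=> v w; rewrite /H /pull Gams.
have csym : connect_sym Gam by exact: sym_connect_sym.
pose comp v := root Gam (f v).
pose D c := [set v | comp v == c].
pose nb v := [set w | H v w].
have Hcomp v w : H v w -> comp v = comp w.
  by move=> h; apply/eqP; rewrite /comp root_connect //; exact: connect1.
(* The two cases of Hall's theorem in the bipartite double cover of a component. *)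
have sel c : exists X : {set V}, X \subset D c /\
    #|D c| + #|\bigcup_(x in X) nb x| <= m + #|X|.
  have [//|[X [g [XD mX gI gr]]]] := hall_deficiency (D c) nb m.
  exfalso.
  have [||vs [c1 u1 s1]] := hcyc V T G f Gam n X g c Gs Gi Gams TM hG hn on nV gI.
  - move=> x xX; split; first by have := gr x xX; rewrite inE.
    have := subsetP XD x xX; rewrite inE => /eqP <-.
    by rewrite csym connect_root.
  - apply: ltnW; apply: leq_trans (ltn_ceil (p.+1 * n) p0) _.
    by rewrite mulnC leq_mul2l mX orbT.
  - exact: nocyc c1 u1 s1.
have [X hX] := fin_all_exists sel.
pose NX c := \bigcup_(x in X c) nb x.
pose x v := v \in X (comp v); pose nx v := v \in NX (comp v).
(* The complement of [X] and the set [NX] form a vertex cover of the double cover. [S] holds the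
   vertices covered in both copies and [R] those covered in just one, so [2 |S| + |R|] is the size
   of the cover. *)
exists H, (fun v => enum_rank (comp v) : nat), [set v | ~~ x v && nx v], [set v | (~~ x v) (+) nx v].
split=> //.
- split=> //.
  + by move=> v w /Hcomp ->.
  + move=> v w h; have e := Hcomp _ _ h.
    have h1 : x v -> nx w.
      by rewrite /x /nx e => xv; apply/bigcupP; exists v; rewrite // inE.
    have h2 : x w -> nx v.
      by rewrite /x /nx -e => xw; apply/bigcupP; exists w; rewrite // inE Hs.
    rewrite !inE; move: h1 h2; case: (x v); case: (x w); case: (nx v); case: (nx w);
      move=> h1 h2; rewrite /=; try (by constructor 1); try (by constructor 2);
      try (by constructor 3); by [have := h1 isT | have := h2 isT].
  + rewrite disjoint_subset; apply/subsetP=> v; rewrite !inE.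
    by case/andP=> -> ->.
- move=> v; set c := comp v.
  have -> : [set w | (enum_rank (comp w) : nat) == enum_rank c] = D c.
    by apply/setP=> w; rewrite !inE (inj_eq val_inj) (inj_eq enum_rank_inj).
  have [XD hm] := hX c.
  have ND : NX c \subset D c.
    apply/bigcupsP=> u uX; apply/subsetP=> w; rewrite inE => /Hcomp h.
    by have := subsetP XD u uX; rewrite !inE h.
  set S := [set w | _ && _]; set R := [set w | _ (+) _].
  pose A := D c :\: X c.
  have cA : #|A| + #|X c| = #|D c|.
    by rewrite /A cardsD (setIidPr XD) subnK // subset_leq_card.
  have inD w : w \in D c -> x w = (w \in X c) /\ nx w = (w \in NX c).
    by rewrite inE /x /nx => /eqP ->.
  have hS : #|S :&: D c| <= #|A :&: NX c|.
    apply: subset_leq_card; apply/subsetP=> w /setIP[wS wD].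
    have [e1 e2] := inD w wD; move: wS; rewrite inE e1 e2 => /andP[h1 h2].
    by rewrite in_setI in_setD h1 wD h2.
  have hR : #|R :&: D c| <= #|A :\: NX c| + #|NX c :\: A|.
    apply: leq_trans (_ : #|(A :\: NX c) :|: (NX c :\: A)| <= _); last first.
      exact: leq_card_setU.
    apply: subset_leq_card; apply/subsetP=> w /setIP[wS wD].
    have [e1 e2] := inD w wD; move: wS; rewrite inE e1 e2 !(in_setU, in_setD) wD.
    by case: (w \in X c); case: (w \in NX c).
  have := cardsID (NX c) A; have := cardsID A (NX c); rewrite setIC.
  rewrite -/(NX c) in hm; lia.
Qed.

Lemma cycle_nth (V : eqType) (G : rel V) x0 (vs : seq V) i :
  cycle G vs -> i < size vs -> G (nth x0 vs i) (nth x0 vs (i.+1 %% size vs)).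
Proof.
case: vs => // x s /= /(pathP x0) h hi.
have := h i; rewrite size_rcons => /(_ hi); rewrite nth_rcons.
have -> : nth x0 (x :: rcons s x) i = nth x0 (x :: s) i.
  by rewrite -rcons_cons nth_rcons /= hi.
move: hi; rewrite ltnS leq_eqVlt => /predU1P[->|his].
  by rewrite ltnn eqxx modnn.
by rewrite his modn_small.
Qed.

Lemma contains_cycle (G : sgraph) (vs : seq G) n : size vs = n -> uniq vs ->
  cycle (@adj G) vs -> contains_copy (cycle_graph n) G.
Proof.
case: n => [|n] zs us cs.
  apply/existsP; exists [ffun x : cycle_graph 0 => match x with Ordinal m i => False_rect _ (notF i) end].
  apply/andP; split; last by apply/forallP; case.
  by apply/injectiveP; case.
have [x0 _] : exists x0 : G, True by case: vs zs {us cs} => // x0; exists x0.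
apply/existsP; exists [ffun i : 'I_n.+1 => nth x0 vs i]; apply/andP; split.
  apply/injectiveP=> i j; rewrite !ffunE => /eqP.
  by rewrite nth_uniq ?zs // => /eqP/val_inj.
apply/forallP=> i; apply/forallP=> j; apply/implyP; rewrite !ffunE.
case/andP=> _ /orP[] /eqP e; have := cycle_nth x0 cs.
  by move/(_ i); rewrite zs e; apply; exact: ltn_ord.
by move/(_ j); rewrite zs e adj_sym; apply; exact: ltn_ord.
Qed.

(** * Choice of parameters *)

(** With [p m <= p.+1 n] and [p t <= n], the numerical hypothesis is [p] times the hypothesis [hN]
    of the counting section. *)
Theorem monochromatic_cycle (k p : nat) : 2 < k -> 0 < p -> exists n0,
  forall n N, n0 <= n -> ~~ odd n -> n <= N -> N <= k.+1 * n ->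
  (2 * k * p.+1 + 6) * n < 2 * p * N + p.+1 * n ->
  ramsey_prop k (cycle_graph n) N.
Proof.
(* With this [d] the pairs lost in all colours number at most [N^2 / (8 P^2)]. The diagonal adds
   [N], no more than that again once [8 P^2 <= N], and [N <= 2 P t] turns the sum into [t^2]. *)
move=> k2 p0; pose P := p * k.+1; pose d := 64 * k * P ^ 2.
have P0 : 0 < P by rewrite muln_gt0 p0.
have P2 : 0 < P ^ 2 by rewrite expn_gt0 P0.
have d0 : 0 < d by rewrite /d; nia.
have [n0 hn0] := cycle_free_structure p0 d0.
exists (n0 + 8 * P ^ 2).+1 => n N hn on nN Nk hN.
have n1 : 0 < n by lia.
rewrite /ramsey_prop (leq_trans n1 nN) /=.
apply/forallP=> c; apply: contraT; rewrite negb_exists => /forallP noc; exfalso.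
set V : finType := complete_graph N.
have cV : #|V| = N by rewrite card_ord.
have str i : exists Q : rel V * (V -> nat) * ({set V} * {set V}),
    let: (H, comp, (W, R)) := Q in
  [/\ [/\ symmetric H, (forall v w, H v w -> comp v = comp w),
      (forall v w, H v w -> [\/ v \in W, w \in W | (v \in R) && (w \in R)])
    & [disjoint W & R]],
    (forall v, 2 * #|W :&: [set w | comp w == comp v]| +
         #|R :&: [set w | comp w == comp v]| <= (p.+1 * n) %/ p)
  & d * rel_card (fun v w => colour_adj c i v w && ~~ H v w) <= 8 * #|V| ^ 2].
  have [||||||H [comp [S [R h]]]] := hn0 V (colour_adj c i) n.
  - exact: colour_adj_sym.
  - exact: colour_adj_irrefl.
  - lia.
  - exact: on.
  - by rewrite cV.
  - move=> vs cs us zs; case/negP: (noc i).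
    exact: (@contains_cycle (colour_class c i) vs).
  - by exists (H, comp, (S, R)).
have [Q hQ] := fin_all_exists str.
set m := (_ %/ _) in hQ.
pose H i := (Q i).1.1; pose comp i := (Q i).1.2.
pose S i := (Q i).2.1; pose R i := (Q i).2.2.
have {}hQ i : [/\ [/\ symmetric (H i), (forall v w, H i v w -> comp i v = comp i w),
      (forall v w, H i v w -> [\/ v \in S i, w \in S i | (v \in R i) && (w \in R i)])
    & [disjoint S i & R i]],
    (forall v, 2 * #|S i :&: [set w | comp i w == comp i v]| +
         #|R i :&: [set w | comp i w == comp i v]| <= m)
  & d * rel_card (fun v w => colour_adj c i v w && ~~ H i v w) <= 8 * #|V| ^ 2].
  by have := hQ i; rewrite /H /comp /S /R; case: (Q i) => -[? ?] [? ?].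
pose t := N %/ P.
have mlow : n <= m.
  by rewrite /m leq_divRL // mulnC leq_mul2r leqnSn orbT.
have mup : p * m <= p.+1 * n by rewrite mulnC leq_trunc_div.
have tn : p * t <= n.
  have : t * P <= N by rewrite leq_trunc_div.
  rewrite /P; move: Nk; nia.
have tm : t <= m by apply: leq_trans mlow; apply: leq_trans tn; rewrite leq_pmull.
pose unc := rel_card (fun v w : V => [forall i, ~~ H i v w]).
have lost : 8 * P ^ 2 * (\sum_i rel_card (fun v w => colour_adj c i v w && ~~ H i v w))
    <= N ^ 2.
  have k8 : 0 < 8 * k by lia.
  rewrite -(leq_pmul2l k8) mulnA [in X in X <= _]big_distrr /=.
  apply: leq_trans (_ : \sum_(i < k) 8 * #|V| ^ 2 <= _); last first.
    by rewrite sum_nat_const card_ord cV mulnA (mulnC k).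
  apply: leq_sum => i _; have [_ _] := hQ i; apply: leq_trans.
  by rewrite leq_mul2r; apply/orP; right; rewrite /d; lia.
have unc_le : unc <= N + \sum_i rel_card (fun v w => colour_adj c i v w && ~~ H i v w).
  rewrite /unc /rel_card.
  apply: leq_trans (_ : #|(fun v : V => (v, v)) @: [set: V] :|: \bigcup_i
     [set q | colour_adj c i q.1 q.2 && ~~ H i q.1 q.2]| <= _).
    apply: subset_leq_card; apply/subsetP=> -[v w]; rewrite !inE /= => /forallP h.
    have [->|vw] := eqVneq v w; first by rewrite imset_f.
    apply/orP; right.
    have evw : [set v; w] \in edge_set (complete_graph N).
      by apply/imsetP; exists (v, w); rewrite // inE.
    pose e : edge (complete_graph N) := Sub [set v; w] evw.
    apply/bigcupP; exists (c e) => //; rewrite inE /= h andbT.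
    by apply/existsP; exists e; rewrite !eqxx.
  apply: leq_trans (leq_card_setU _ _) _; apply: leq_add.
    by apply: leq_trans (leq_imset_card _ _) _; rewrite cardsT cV.
  exact: leq_card_bigcup.
have Ht : \sum_v #|[set w | [forall i, ~~ H i v w]]| <= t ^ 2.
  have -> : \sum_v #|[set w | [forall i, ~~ H i v w]]| = unc.
    have -> : unc = edges (fun v w : V => [forall i, ~~ H i v w]) setT setT.
      by apply: eq_card => q; rewrite !inE.
    rewrite edges_sum; apply: eq_big => [v|v _]; first by rewrite inE.
    by apply: eq_card => w; rewrite !inE.
  have N8 : 8 * P ^ 2 <= N by lia.
  have NP : N <= 2 * P * t.
    have h1 : N < t.+1 * P by rewrite ltn_ceil.
    have t0 : 0 < t.
      rewrite divn_gt0 //; apply: leq_trans N8.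
      by rewrite -mulnn mulnA leq_pmull // muln_gt0.
    apply: leq_trans (ltnW h1) _.
    by rewrite mulSn -mulnA mul2n -addnn [P * t]mulnC leq_add2r leq_pmull.
  have h2 : 8 * P ^ 2 * unc <= 2 * N ^ 2.
    have := leq_mul (leqnn (8 * P ^ 2)) unc_le; rewrite mulnDr.
    have := leq_mul N8 (leqnn N); rewrite mulnn; move: lost; lia.
  have h3 : N ^ 2 <= 4 * P ^ 2 * t ^ 2.
    by rewrite -(expnMn 2 P 2) -expnMn leq_exp2r.
  have PP : 0 < 4 * P ^ 2 by lia.
  rewrite -(leq_pmul2l PP); lia.
apply: (@count_contradiction V 'I_k H comp S R m t) => //.
- by move=> i; case: (hQ i) => -[].
- by move=> i; case: (hQ i) => -[].
- by move=> i; case: (hQ i) => -[].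
- by move=> i; case: (hQ i) => -[].
- by move=> i v; case: (hQ i).
- by apply: leq_trans mlow.
- by rewrite card_ord.
- rewrite card_ord cV -(ltn_pmul2l p0).
  move: mlow mup tn hN k2; clear; nia.
Qed.

Lemma ramsey_number_le k G N : ramsey_prop k G N -> ramsey_number k G <= N.
Proof. by rewrite /ramsey_number; case: ex_minnP => m _; apply. Qed.

(** Cleared of denominators, this is the bound [(k - 1/2 + (k + 3) / p) n]. *)
Theorem ramsey_even_cycle_le (k p : nat) : 2 < k -> 2 * k + 5 <= p -> exists n0,
  forall n, n0 <= n -> ~~ odd n ->
  2 * p * ramsey_number k (cycle_graph n) + p * n <= (2 * k * p + 2 * k + 6) * n.
Proof.
move=> k2 kp; have p0 : 0 < p by lia.
have [n0 hn0] := monochromatic_cycle k2 p0.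
exists (n0 + 2 * p) => n hn on.
(* The required inequality on [N] reads [c n < 2 p N], and [N] is the least solution. Rounding costs
   at most [2 p <= n], which raises the [5] to [6]. *)
pose c := 2 * k * p + 2 * k + 5 - p.
have hc : c + p = 2 * k * p + 2 * k + 5 by rewrite /c subnK //; nia.
have p20 : 0 < 2 * p by lia.
pose N := ((c * n) %/ (2 * p)).+1.
have Nlow : c * n < 2 * p * N by rewrite [_ * N]mulnC ltn_ceil.
have Nup : 2 * p * N <= c * n + 2 * p.
  by rewrite /N mulnS addnC leq_add2r [_ * (_ %/ _)]mulnC leq_trunc_div.
have c1 : 2 * p <= c by nia.
have c2 : c <= 2 * p * k by nia.
have n1 : 2 * p <= n by lia.
have hR : ramsey_number k (cycle_graph n) <= N.
  apply: ramsey_number_le; apply: hn0 => //.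
  - lia.
  - by rewrite -(leq_pmul2l p20); apply: ltnW; apply: leq_ltn_trans Nlow;
      rewrite leq_mul2r c1 orbT.
  - rewrite -(leq_pmul2l p20); apply: leq_trans Nup _.
    have := leq_mul c2 (leqnn n); have := leq_mul n1 (leqnn n).
    have := leq_pmulr (2 * p) (_ : 0 < n); rewrite mulSn mulnDr mulnA; lia.
  - have : (2 * k * p.+1 + 6) * n = (c + p.+1) * n by rewrite [c + _]addnS hc mulnS; congr (_ * n); lia.
    by move=> ->; rewrite mulnDl ltn_add2r.
have := leq_mul (leqnn (2 * p)) hR.
have : (c + p) * n = (2 * k * p + 2 * k + 5) * n by rewrite hc.
rewrite !mulnDl; lia.
Qed.

(* The asymptotic form over the reals *)
From mathcomp Require Import all_boot all_order all_algebra.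
From mathcomp Require Import lra.
From mathcomp Require Import all_classical all_reals all_analysis.
Import Order.TTheory GRing.Theory Num.Theory numFieldNormedType.Exports.
Local Open Scope classical_set_scope.
Local Open Scope ring_scope.

Theorem theorem2 (R : realType) (k : nat) (hk : (4 <= k)%N) :
  exists o : nat -> R,
    (o n @[n --> \oo] --> (0 : R)) /\
    (forall n : nat, (3 <= n)%N -> ~~ odd n ->
       (ramsey_number k (cycle_graph n))%:R <= (k%:R - 1 / 2 + o n) * n%:R).
Proof.
pose excess n : R := (ramsey_number k (cycle_graph n))%:R / n%:R - (k%:R - 1 / 2).
(* The error term is the positive part of the excess at even [n], so the inequality is immediate and
   only the limit needs proof. *)
exists (fun n => if odd n then 0 else Num.max 0 (excess n)); split; last first.
  move=> n n3 on; rewrite (negbTE on) -ler_pdivrMr ?ltr0n; last by apply: leq_trans n3.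
  by rewrite -lerBlDl le_max lexx orbT.
apply/cvgrPdist_le => e e0.
(* Large enough for [ramsey_even_cycle_le] and for [(k + 3) / p <= e / 2]. *)
pose p := (2 * k + 5 + Num.truncn ((2 * k + 6)%:R / e)).+1.
have hp : (2 * k + 6)%:R / e <= p%:R :> R.
  apply: ltW; apply: lt_le_trans (Num.Theory.truncnS_gt _) _.
  by rewrite ler_nat ltnS leq_addl.
have [||n0 hn0] := @ramsey_even_cycle_le k p; first exact: leq_trans hk.
  by rewrite leqW // leq_addr.
exists (n0 + 3)%N => // n /= hn; rewrite sub0r normrN.
case: ifPn => on; first by rewrite normr0 ltW.
rewrite ger0_norm ?le_max ?lexx // ge_max ltW //=.
have n0' : 0 < n%:R :> R by rewrite ltr0n (leq_trans _ hn) // addn3.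
have p0 : 0 < p%:R :> R by rewrite ltr0n.
rewrite /excess lerBlDr ler_pdivrMr //.
have := hn0 n (leq_trans (leq_addr _ _) hn) on.
rewrite -(ler_nat R) !(natrD, natrM).
move: hp; rewrite ler_pdivrMr // !(natrD, natrM).
move: (ramsey_number _ _)%:R k%:R p%:R n%:R n0' p0 => r K q m m0 q0 hp h.
rewrite -(ler_pM2l (_ : 0 < 2 * q)) ?mulr_gt0 //.
have := ler_wpM2r (ltW m0) hp.
have : 0 <= q * e * m by rewrite !mulr_ge0 // ltW.
move: h; lra.
Qed.
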